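(* Let $G$ be a finitely generated nilpotent group. Then $G$ is $\mathbb{Q}\mathbf{CF}$ if and only if $G$ is virtually cyclic.
   Context: All generating sets are finite and symmetric (closed under inverses). For a group $G$ with finite generating set $S$, $d_S(g)$ denotes the word length of $g \in G$ with respect to $S$ (distance from $e$ to $g$ in the Cayley graph $\Gamma(G,S)$). A word $w \in S^*$ of length $|w|$ is also regarded as the element of $G$ it represents. A word $w\in S^*$ is $(\lambda,\epsilon)$-quasigeodesic in $\Gamma(G,S)$ if $|u| \le \lambda d_S(u) + \epsilon$ for every contiguous subword $u$ of $w$. A finitely generated group $G$ is $\mathbb{Q}\mathbf{CF}$ if for all rational $\lambda \ge 1$, all real $\epsilon \ge 0$ and all finite generating sets $S$ of $G$, the set of $(\lambda,\epsilon)$-quasigeodesic words in $\Gamma(G,S)$ is a context-free language over $S$. A group is virtually cyclic if it has a cyclic subgroup of finite index (in particular finite groups are virtually cyclic). *)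

(* Defs.v *)
From HB Require Import structures.
From mathcomp Require Import all_boot all_order all_algebra.
From mathcomp Require Import finmap.
From mathcomp Require Import boolp classical_sets cardinality reals.
From Stdlib Require Import Relation_Operators.

Set Implicit Arguments.
Unset Strict Implicit.
Unset Printing Implicit Defensive.

Local Open Scope classical_set_scope.

Section ContextFree.

(* The rules form a finite list, so a grammar is a finite object. *)
Record grammar (A : finType) := Grammar {
  nonterminal : finType;
  start : nonterminal;
  rules : seq (nonterminal * seq (nonterminal + A))
}.

Variable A : finType.

Definition rewrite_step (gr : grammar A)
    (x y : seq (nonterminal gr + A)) : Prop :=
  exists (u v : seq (nonterminal gr + A)) (X : nonterminal gr)
         (rhs : seq (nonterminal gr + A)),
    [/\ (X, rhs) \in rules gr,
        x = u ++ inl X :: v &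
        y = u ++ rhs ++ v].

Definition language_of (gr : grammar A) : set (seq A) :=
  [set w | clos_refl_trans _ (@rewrite_step gr) [:: inl (start gr)]
             [seq inr a | a <- w]].

Definition context_free (L : set (seq A)) : Prop :=
  exists gr : grammar A, language_of gr = L.

End ContextFree.

Section Groups.

(* [groupType] is the structure of arbitrary, possibly infinite, groups. *)
Variable G : groupType.

Definition is_subgroup (H : set G) : Prop :=
  H 1%g /\ forall x y, H x -> H y -> H (x / y)%g.

Definition generated (A : set G) : set G := smallest is_subgroup A.

Definition left_cosets (H : set G) : set (set G) :=
  [set [set (g * h)%g | h in H] | g in [set: G]].

Definition finite_index (H : set G) : Prop := finite_set (left_cosets H).

Fixpoint lower_central_series (n : nat) : set G :=
  if n is m.+1 then
    generated [set z | exists x y, lower_central_series m x /\ z = [~ x, y]%g]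
  else [set: G].

(* Generating sets are symmetric by convention. *)
Definition generating_set (S : {fset G}) : Prop :=
  (forall s, s \in S -> (s^-1)%g \in S) /\ generated [set` S] = [set: G].

Definition eval_word (S : {fset G}) (w : seq S) : G :=
  (\prod_(s <- w) val s)%g.

Definition has_word_of_size (S : {fset G}) (g : G) (n : nat) : Prop :=
  exists w : seq S, size w = n /\ eval_word w = g.

(* When no word over S represents g, which cannot happen for a generating set,
   the value is the dummy 0. *)
Definition word_length (S : {fset G}) (g : G) : nat :=
  if pselect (exists n, `[< has_word_of_size S g n >]) is left ex
  then ex_minn ex else 0.

Definition quasigeodesic (R : realType) (S : {fset G}) (lambda : rat)
    (epsilon : R) (w : seq S) : Prop :=
  forall u : seq S, infix u w ->
    ((size u)%:R <= ratr lambda * (word_length S (eval_word u))%:R + epsilon)%R.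

End Groups.

Definition finitely_generated (G : groupType) : Prop :=
  exists S : {fset G}, generating_set S.

Definition nilpotent_group (G : groupType) : Prop :=
  exists n, lower_central_series n = [set 1%g :> G].

Definition virtually_cyclic (G : groupType) : Prop :=
  exists x : G, finite_index (generated [set x]).

Definition QCF (R : realType) (G : groupType) : Prop :=
  forall (lambda : rat) (epsilon : R) (S : {fset G}),
    (1 <= lambda)%R -> (0 <= epsilon)%R -> generating_set S ->
    context_free [set w : seq S | quasigeodesic lambda epsilon w].

(* Main.v *)
(** A virtually cyclic group is quasi-isometric to a line, and there a geodesic
    joining the endpoints of a quasigeodesic passes within a uniform distance of
    each of its points.  Hence whether a quasigeodesic [w] can be prolonged by
    [v] depends only on the defects [q |u| - p len (u b)] of the suffixes [u] of
    [w], for [b] in a fixed ball: finitely many states, so the language is even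
    regular.

    Conversely, a finitely generated nilpotent group that is not virtually
    cyclic has two homomorphisms to the rationals that are dual to a pair [a],
    [b] of generators.  The spiral [a^i b^j a^-k b^-l] with [i <= j << k << l] is
    then quasigeodesic by lower bounds in the abelianization.  In a nilpotent
    group [len (a^m g a^-m) = o(m)] for fixed [g], so [a^k b^j a^-k] and
    [b^l a^-k b^-l] fail to be quasigeodesic.  Ogden's lemma with the letter [a]
    marked pumps [a] together with at most one other block, and so produces a
    word containing one of these two bad subwords. *)

From HB Require Import structures.
Require Import Defs.
From mathcomp Require Import all_boot all_order all_algebra.
From mathcomp Require Import finmap zify.
From mathcomp Require Import boolp classical_sets cardinality reals.
From Stdlib Require Import Relation_Operators Operators_Properties.

Set Implicit Arguments.
Unset Strict Implicit.
Unset Printing Implicit Defensive.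

(** * Context-free languages *)

(** Pumping might repeat a block that straddles two letters, and the result would leave the family
    of spirals. Ogden's lemma is therefore proved relative to a finite automaton: both repeated
    blocks are loops of it. For the automaton that remembers the last letter, and for words sorted
    by letter, a loop is a power of one letter, so pumping only changes exponents. The stretch
    constant has to be fixed before the spiral. It can be, since it depends only on Lipschitz
    constants of the two homomorphisms. The exponents are then chosen in order: i = j beyond Ogden's
    constant, k for the conjugates of b^j, l for the conjugates of a^-k. The obstacle to the
    sublinear bound is that the obvious estimate of a commutator is only linear. The bound is
    obtained in the group of sequences in G, where replacing n by t n raises the sequence a^n to the
    power t; congruences modulo the lower central series then compare lengths at different
    scales. *)

Section Derivations.

Variables (A : finType) (gr : grammar A).

Local Notation symbol := (nonterminal gr + A)%type.
Local Notation derives := (clos_refl_trans _ (@rewrite_step A gr)).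
Local Notation terminals w := [seq (inr a : symbol) | a <- w].

Lemma derives_ctx (p s x y : seq symbol) :
  derives x y -> derives (p ++ x ++ s) (p ++ y ++ s).
Proof.
elim=> {x y} [x y [u [v [X [rhs [Xrhs -> ->]]]]]|x|x y z _ IHx _ IHy].
- apply: rt_step; exists (p ++ u), (v ++ s), X, rhs.
  by split=> //; rewrite -?catA.
- exact: rt_refl.
- exact: rt_trans IHy.
Qed.

Lemma derives_cat (x1 y1 x2 y2 : seq symbol) :
  derives x1 y1 -> derives x2 y2 -> derives (x1 ++ x2) (y1 ++ y2).
Proof.
move=> /(derives_ctx [::] x2) D1 /(derives_ctx y1 [::]).
by rewrite !cats0; apply: rt_trans.
Qed.

Lemma derives_rule X rhs (y : seq symbol) :
  (X, rhs) \in rules gr -> derives rhs y -> derives [:: inl X] y.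
Proof.
move=> Xrhs; apply: rt_trans; apply: rt_step.
by exists [::], [::], X, rhs; rewrite cats0.
Qed.

(* Parse forests in first-child/next-sibling form, so that plain structural
   induction applies. *)
Inductive forest : Type :=
  | Leaf : forest
  | Ter : A -> forest -> forest
  | Non : nonterminal gr -> forest -> forest -> forest.

Fixpoint yield f : seq A :=
  match f with
  | Leaf => [::]
  | Ter a r => a :: yield r
  | Non _ c r => yield c ++ yield r
  end.

Fixpoint roots f : seq symbol :=
  match f with
  | Leaf => [::]
  | Ter a r => inr a :: roots r
  | Non X _ r => inl X :: roots r
  end.

Fixpoint valid f : bool :=
  match f with
  | Leaf => true
  | Ter _ r => valid r
  | Non X c r => [&& (X, roots c) \in rules gr, valid c & valid r]
  end.

Fixpoint forest_cat f g : forest :=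
  match f with
  | Leaf => g
  | Ter a r => Ter a (forest_cat r g)
  | Non X c r => Non X c (forest_cat r g)
  end.

Lemma yield_cat f g : yield (forest_cat f g) = yield f ++ yield g.
Proof. by elim: f => //= [a r ->|X c _ r ->] //; rewrite catA. Qed.

Lemma roots_cat f g : roots (forest_cat f g) = roots f ++ roots g.
Proof. by elim: f => //= [a r ->|X c _ r ->]. Qed.

Lemma valid_cat f g : valid (forest_cat f g) = valid f && valid g.
Proof. by elim: f => //= X c _ r ->; rewrite !andbA. Qed.

Lemma roots_catP f x y : valid f -> roots f = x ++ y ->
  exists g h, [/\ valid g, valid h, roots g = x, roots h = y &
                  yield f = yield g ++ yield h].
Proof.
elim: x f => [|s x IH] f vf; first by exists Leaf, f.
case: f vf => //= [a r vr|X c r /and3P[Xc vc vr]] [<- /(IH _ vr)].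
- by move=> [g [h [vg vh <- <- ->]]]; exists (Ter a g), h.
- move=> [g [h [vg vh <- <- ->]]]; exists (Non X c g), h.
  by split=> //=; rewrite ?Xc ?vc // catA.
Qed.

Lemma forest_derives f : valid f -> derives (roots f) (terminals (yield f)).
Proof.
elim: f => /= [_|a r IH /IH|X c IHc r IHr /and3P[Xc /IHc Dc /IHr Dr]].
- exact: rt_refl.
- by move=> /(derives_ctx [:: inr a] [::]); rewrite !cats0.
- rewrite map_cat -cat1s; apply: derives_cat Dr.
  exact: derives_rule Xc Dc.
Qed.

(** Induction on the derivation from its end: in the forest of the later sentential form, the roots
    that spell [rhs] are gathered under a new node [X]. *)
Lemma derives_forest x w : derives x (terminals w) ->
  exists f, [/\ valid f, roots f = x & yield f = w].
Proof.
move=> /clos_rt_rt1n_iff; move: {1 3}(terminals w) (erefl (terminals w)) => y.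
move=> /[swap]; elim=> {x y} [y ->|x y z [u [v [X [rhs [Xrhs -> ->]]]]] _ IH].
- elim: w => [|a w [f [vf rf yf]]]; first by exists Leaf.
  by exists (Ter a f); split=> //=; rewrite ?rf ?yf.
- move=> /IH[f [vf rf <-]].
  have [g [h [vg vh rg rh ->]]] := roots_catP vf rf.
  have [h1 [h2 [v1 v2 r1 r2 ->]]] := roots_catP vh rh.
  exists (forest_cat g (Non X h1 h2)).
  by rewrite valid_cat roots_cat yield_cat /= r1 vg v1 v2 rg r2 Xrhs.
Qed.

End Derivations.

(** * Ogden's lemma relative to a finite automaton *)

Section Pumping.

Variables (A : finType) (M : pred A) (gr : grammar A).
Variables (Q : finType) (delta : Q -> A -> Q).

Local Notation symbol := (nonterminal gr + A)%type.
Local Notation derives := (clos_refl_trans _ (@rewrite_step A gr)).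
Local Notation terminals w := [seq (inr a : symbol) | a <- w].
Local Notation label := (nonterminal gr * Q * Q)%type.
Local Notation run := (foldl delta).
Local Notation forest := (forest gr).

Definition pow_word (n : nat) (v : seq A) : seq A := flatten (nseq n v).

(* Each tree node is labelled by its nonterminal together with the states of
   the automaton before and after reading the yield of the node. *)
Fixpoint labels (f : forest) (q : Q) : {set label} :=
  match f with
  | Leaf => finset.set0
  | Ter a r => labels r (delta q a)
  | Non X c r => let q' := run q (yield c) in
      (X, q, q') |: (labels c q :|: labels r q')
  end.

Fixpoint marked_roots (f : forest) : nat :=
  match f with
  | Leaf => 0
  | Ter a r => M a + marked_roots r
  | Non X c r => (0 < count M (yield c)) + marked_roots r
  end.

Lemma marked_roots_le_count f : marked_roots f <= count M (yield f).
Proof. by elim: f => //= [a r|X c _ r]; rewrite ?count_cat; lia. Qed.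

Lemma marked_roots_le_size f : marked_roots f <= size (roots f).
Proof. by elim: f => //= [a r|X c _ r]; lia. Qed.

(** Every marked root, except the one whose tree contains [v], contributes a marked letter outside
    [v]. This is the count inequality, and it later ensures that something marked is pumped. *)
Lemma label_subtree f q X q1 q2 : valid f -> (X, q1, q2) \in labels f q ->
  exists u v z, [/\ yield f = u ++ v ++ z,
    derives [:: inl X] (terminals v),
    run q u = q1 /\ run q1 v = q2,
    count M v + marked_roots f <= (count M (yield f)).+1 &
    forall v', derives [:: inl X] (terminals v') ->
      derives (roots f) (terminals (u ++ v' ++ z))].
Proof.
elim: f q => [|a r IH|Y c IHc r IHr] q /=; first by rewrite finset.inE.
- move=> vr /(IH _ vr)[u [v [z [yr Dv [r1 r2] le D]]]].
  exists (a :: u), v, z; split=> //=; first by rewrite yr.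
    by lia.
  move=> v' /D; exact: (@derives_cat _ _ [:: inr a] [:: inr a] _ _ (rt_refl _ _ _)).
case/and3P=> Yc vc vr; rewrite !inE => /orP[/eqP[-> -> ->]|/orP[]].
- exists [::], (yield c), (yield r); split=> //=.
  + exact: derives_rule Yc (forest_derives vc).
  + by rewrite count_cat; have := marked_roots_le_count r; lia.
  + move=> v' Dv'; rewrite map_cat -cat1s.
    exact: derives_cat Dv' (forest_derives vr).
- move=> /(IHc _ vc)[u [v [z [yc Dv [r1 r2] le D]]]].
  exists u, v, (z ++ yield r); split=> //=; first by rewrite yc -!catA.
  + rewrite yc !count_cat; have := marked_roots_le_count r; lia.
  + move=> v' /D Dc; rewrite !catA map_cat -catA -cat1s.
    exact: derives_cat (derives_rule Yc Dc) (forest_derives vr).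
- move=> /(IHr _ vr)[u [v [z [yr Dv [r1 r2] le D]]]].
  exists (yield c ++ u), v, z; split=> //=; first by rewrite yr -!catA.
  + by rewrite foldl_cat.
  + by rewrite count_cat; lia.
  + move=> v' /D Dr; rewrite -catA map_cat -cat1s.
    exact: derives_cat (derives_rule Yc (forest_derives vc)) Dr.
Qed.

(** Ogden's decomposition, with the demand that [v] and [v'] be loops of the automaton in place of a
    bound on the length of the pumped part. *)
Definition pumpable (x : seq symbol) (q : Q) (w : seq A) : Prop :=
  exists u v y v' z, [/\ w = u ++ v ++ y ++ v' ++ z,
    run (run q u) v = run q u,
    run (run q (u ++ v ++ y)) v' = run q (u ++ v ++ y),
    0 < count M (v ++ v') &
    forall t, derives x (terminals (u ++ pow_word t v ++ y ++ pow_word t v' ++ z))].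

Lemma pow_wordSr n v : pow_word n.+1 v = pow_word n v ++ v.
Proof.
elim: n => [|n IH]; first by rewrite /pow_word /= cats0.
by rewrite -[LHS]/(v ++ pow_word n.+1 v) {1}IH catA.
Qed.

Lemma pumpable_ctx x1 x x2 q w1 w w2 :
  derives x1 (terminals w1) -> derives x2 (terminals w2) ->
  pumpable x (run q w1) w -> pumpable (x1 ++ x ++ x2) q (w1 ++ w ++ w2).
Proof.
move=> D1 D2 [u [v [y [v' [z [-> r1 r2 pos D]]]]]].
exists (w1 ++ u), v, y, v', (z ++ w2); split=> //.
- by rewrite -!catA.
- by rewrite !foldl_cat.
- by rewrite -catA !(foldl_cat _ _ w1).
- move=> t; rewrite -catA map_cat; apply: derives_cat D1 _.
  by rewrite !catA map_cat -!catA; apply: derives_cat (D t) D2.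
Qed.

Lemma self_embedding_pumpable X q u v z :
  derives [:: inl X] (terminals v) ->
  (forall v', derives [:: inl X] (terminals v') ->
     derives [:: inl X] (terminals (u ++ v' ++ z))) ->
  run q u = q -> run q v = run q (u ++ v ++ z) -> 0 < count M (u ++ z) ->
  pumpable [:: inl X] q (u ++ v ++ z).
Proof.
move=> Dv D ru rv pos; exists [::], u, v, z, [::]; split=> //=.
- by rewrite cats0.
- by rewrite -foldl_cat -catA -rv foldl_cat ru.
- elim=> [|t IH]; first by rewrite /= cats0.
  move: (D _ IH); rewrite !cats0 [pow_word t.+1 z]pow_wordSr.
  by rewrite -[pow_word t.+1 u]/(u ++ pow_word t u) -!catA.
Qed.

(** The successor keeps the base positive, so that its powers are monotone in the exponent. *)
Let branching := (\max_(r <- rules gr) size r.2).+1.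

Lemma size_rhs_branching X rhs : (X, rhs) \in rules gr -> size rhs <= branching.
Proof.
by move=> Xr; apply: leqW; exact: (@leq_bigmax_seq _ _ predT (fun r => size r.2) _ Xr).
Qed.

(* A child of a branching node has strictly fewer marked leaves than its
   parent, so a repeated label below a branching node makes the word pumpable. *)
Lemma marked_bound f q : valid f ->
  pumpable (roots f) q (yield f) \/
  count M (yield f) <= marked_roots f * branching ^ #|labels f q|.
Proof.
elim: f q => [|a r IH|X c IHc r IHr] q /=; first by right.
- move=> vr; case: (IH (delta q a) vr) => [pump|le].
    left; have := @pumpable_ctx [:: inr a] _ [::] q [:: a] _ [::]
      (rt_refl _ _ _) (rt_refl _ _ _) pump.
    by rewrite !cats0.
  right; have : 0 < branching ^ #|labels r (delta q a)| by rewrite expn_gt0.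
  by move: (_ ^ _) le => e; case: (M a) => /=; nia.
case/and3P=> Xc vc vr; have Dr := forest_derives vr.
have Dc := derives_rule Xc (forest_derives vc).
have lift : pumpable [:: inl X] q (yield c) ->
    pumpable (inl X :: roots r) q (yield c ++ yield r).
  by move/(@pumpable_ctx [::] _ (roots r) q [::] _ (yield r) (rt_refl _ _ _) Dr).
have step : pumpable (roots c) q (yield c) -> pumpable [:: inl X] q (yield c).
  move=> [u [v [y [v' [z [-> r1 r2 pos D]]]]]]; exists u, v, y, v', z.
  by split=> // t; apply: derives_rule Xc (D t).
set q' := run q (yield c).
case: (IHr q' vr) => [pump|ler].
  left; have := @pumpable_ctx [:: inl X] _ [::] q _ _ [::] Dc (rt_refl _ _ _) pump.
  by rewrite !cats0.
case: (IHc q vc) => [pump|lec]; first by left; exact/lift/step.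
set E := _ |: _.
have mono (D : {set label}) : D \subset E -> branching ^ #|D| <= branching ^ #|E|.
  by move=> DE; rewrite leq_pexp2l // subset_leq_card.
have lerE : branching ^ #|labels r q'| <= branching ^ #|E|.
  by apply: mono; rewrite /E finset.setUA finset.subsetUr.
have lecE : branching ^ #|labels c q| <= branching ^ #|E|.
  by apply: mono; rewrite /E finset.setUCA finset.subsetUl.
suff [?|le] : pumpable [:: inl X] q (yield c) \/
    count M (yield c) <= branching ^ #|E|; first by left; exact: lift.
  right; rewrite count_cat mulnDl; apply: leq_add.
    by case: (count M (yield c)) le => [|n] le //=; rewrite mul1n.
  by apply: leq_trans ler _; rewrite leq_mul2l lerE orbT.
case: (leqP (marked_roots c) 1) => [le1|gt1].
  right; apply: (leq_trans lec); rewrite -[leqRHS]mul1n.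
  exact: leq_mul.
(* The node branches, so a recurrence of its label below gives a pump. Without one the label is new,
   and the exponent it adds pays for the factor [branching]. *)
have [cX|ncX] := boolP ((X, q, q') \in labels c q).
  left; have [u [v [z [yc Dv [r1 r2] le D]]]] := label_subtree vc cX.
  rewrite yc; apply: self_embedding_pumpable => //.
  - by move=> v' /D; apply: derives_rule Xc.
  - by rewrite -yc r2.
  - by move: le; rewrite yc !count_cat; lia.
right; have szc : marked_roots c <= branching.
  exact: leq_trans (marked_roots_le_size c) (size_rhs_branching Xc).
apply: (leq_trans lec); apply: (@leq_trans (branching ^ #|labels c q|.+1)).
  by rewrite expnS leq_mul2r szc orbT.
rewrite leq_pexp2l //; apply: (@leq_trans #|(X, q, q') |: labels c q|).
  by rewrite cardsU1 ncX.
by rewrite subset_leq_card // /E finset.setUA finset.subsetUl.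
Qed.

End Pumping.

(** The labels are the nonterminals of the usual product of grammar and automaton, so pumping at a
    repeated label respects both. Their number bounds the exponent, and a parse tree has a single
    root. *)
Lemma ogden (A : finType) (M : pred A) (L : set (seq A))
    (Q : finType) (delta : Q -> A -> Q) (q0 : Q) :
  context_free L -> exists N, forall w, L w -> N < count M w ->
  exists u v y v' z, [/\ w = u ++ v ++ y ++ v' ++ z,
    foldl delta q0 (u ++ v) = foldl delta q0 u,
    foldl delta q0 (u ++ v ++ y ++ v') = foldl delta q0 (u ++ v ++ y),
    0 < count M (v ++ v') &
    forall t, L (u ++ pow_word t v ++ y ++ pow_word t v' ++ z)].
Proof.
move=> [gr <-]; set B := (\max_(r <- rules gr) size r.2).+1.
exists (B ^ #|{: nonterminal gr * Q * Q}|) => w.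
move=> /derives_forest[f [vf rf <-]] lt.
case: (marked_bound M delta q0 vf) => [|le].
  rewrite rf => -[u [v [y [v' [z [yf r1 r2 pos D]]]]]].
  exists u, v, y, v', z; split=> //; first by rewrite foldl_cat.
  by rewrite 2!catA foldl_cat -catA.
move: lt; rewrite ltnNge; case/negP; apply: (leq_trans le).
have := marked_roots_le_size M f; rewrite rf /= => le1.
apply: (@leq_trans (1 * B ^ #|labels delta f q0|)); first by rewrite leq_mul2r le1 orbT.
by rewrite mul1n leq_pexp2l // max_card.
Qed.

(** Equal states may become different after one more letter, so the right-linear grammar is a
    nondeterministic automaton: it moves from [st w] to [st (rcons w a)] for every [w]. A run may
    switch to another witness [w] at each step, and the hypothesis permits every switch. *)
Lemma finite_nerode_context_free (A Q : finType) (st : seq A -> Q)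
    (L : set (seq A)) :
  (forall w1 w2 v, st w1 = st w2 -> L (w1 ++ v) -> L (w2 ++ v)) ->
  context_free L.
Proof.
move=> stL.
pose trans := [seq (p.1.1, [:: inr p.1.2; inl p.2]) | p <- enum {: Q * A * Q} &
  `[< exists w, st w = p.1.1 /\ st (rcons w p.1.2) = p.2 >]].
pose final := [seq (q, [::] : seq (Q + A)) | q <- enum Q &
  `[< exists w, st w = q /\ L w >]].
exists (@Grammar A Q (st [::]) (trans ++ final)).
have transP q a q' : reflect (exists w, st w = q /\ st (rcons w a) = q')
    ((q, [:: inr a; inl q']) \in trans).
  apply: (iffP mapP) => [[[[q1 a1] q2]]|ex].
    by rewrite mem_filter /= => /andP[/asboolP ex _] [-> -> ->].
  by exists (q, a, q') => //; rewrite mem_filter mem_enum andbT; apply/asboolP.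
have finalP q : reflect (exists w, st w = q /\ L w) ((q, [::]) \in final).
  apply: (iffP mapP) => [[q1]|ex].
    by rewrite mem_filter /= => /andP[/asboolP ex _] [->].
  by exists q => //; rewrite mem_filter mem_enum andbT; apply/asboolP.
set gr := Grammar _ _.
apply/seteqP; split=> w.
  move=> /derives_forest[f [vf rf <-]] {w}.
  suff gen p q w : roots f = rcons [seq inr a | a <- p] (inl q) ->
      st (w ++ p) = q -> L (w ++ yield f) by exact: (gen [::] _ [::] rf).
  elim: f vf p q w {rf} => [|a r IH|q1 c IHc r _] /=; first by move=> _ [].
    move=> vr [//|a' p] q w /= [<- rr] stw.
    by rewrite -cat_rcons; apply: (IH vr p q) => //; rewrite cat_rcons.
  move=> /and3P[qc vc _] [|//] q w /= [<- r0] {q}; rewrite cats0 => stw.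
  case: r r0 => //= _; rewrite cats0.
  move: qc; rewrite mem_cat => /orP[] in_rules.
    have [[[q2 a] q3] _ [q2E rc]] := mapP in_rules.
    move: in_rules; rewrite rc => /transP[w0 [w0q w0q3]].
    apply: (stL w0); first by rewrite w0q stw.
    by apply: (IHc vc [:: a] q3) => //; rewrite cats1.
  have [q2 _ [q2E rc]] := mapP in_rules.
  move: in_rules; rewrite rc => /finalP[w0 [w0q Lw0]].
  case: c rc {IHc vc} => //= _; apply: (stL w0); first by rewrite w0q stw.
  by rewrite cats0.
move=> Lw; rewrite /language_of /=.
suff gen p s : L (p ++ s) -> clos_refl_trans _ (@rewrite_step A gr)
    [:: inl (st p)] [seq inr a | a <- s] by exact: (gen [::]).
elim: s p => [|a s IH] p; first rewrite cats0 => Lp.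
  apply: (@derives_rule _ gr _ [::]); last exact: rt_refl.
  by rewrite mem_cat; apply/orP; right; apply/finalP; exists p.
rewrite -cat_rcons => /IH D.
apply: (@derives_rule _ gr _ [:: inr a; inl (st (rcons p a))]).
  by rewrite mem_cat; apply/orP; left; apply/transP; exists p.
exact: (@derives_cat _ gr [:: inr a] [:: inr a] _ _ (rt_refl _ _ _) D).
Qed.

(** * Lower central series *)

Local Open Scope classical_set_scope.
Local Open Scope group_scope.

Definition groupE (G : groupType) :=
  (fun x y z : G => esym (mulgA x y z), @invgM G, @invgK G, @mulKg G,
   @mulVKg G, @mulVg G, @mulgV G, @mulg1 G, @mul1g G, @invg1 G).

Section Subgroups.

Variable G : groupType.
Implicit Types (x y u v p : G) (H K P A : set G).

Lemma subgroup1 H : is_subgroup H -> H 1.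
Proof. by case. Qed.

Lemma subgroupV H x : is_subgroup H -> H x -> H x^-1.
Proof. by move=> [H1 HF] Hx; rewrite -[x^-1]mul1g; apply: HF. Qed.

Lemma subgroupM H x y : is_subgroup H -> H x -> H y -> H (x * y).
Proof.
by move=> sH Hx Hy; rewrite -[y]invgK; apply: sH.2 => //; apply: subgroupV.
Qed.

Lemma subgroupX H x n : is_subgroup H -> H x -> H (x ^+ n).
Proof.
move=> sH Hx; elim: n => [|n IH]; first exact: subgroup1.
by rewrite expgS; apply: subgroupM.
Qed.

Lemma subgroup_setT : is_subgroup [set: G].
Proof. by []. Qed.

Lemma generated_subgroup A : is_subgroup (generated A).
Proof.
split; first by move=> H [[]].
by move=> x y gx gy H [sH AH]; apply: sH.2; [apply: gx|apply: gy].
Qed.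

Lemma sub_generated A : A `<=` generated A.
Proof. by move=> x Ax H [_]; apply. Qed.

Lemma generated_min A H : is_subgroup H -> A `<=` H -> generated A `<=` H.
Proof. by move=> sH AH x; apply. Qed.

Lemma subgroupR H x y : is_subgroup H -> H x -> H y -> H [~ x, y].
Proof.
by move=> sH Hx Hy; do ![apply: subgroupM => // | apply: subgroupV => //].
Qed.

Definition expgz x (z : int) : G :=
  match z with Posz n => x ^+ n | Negz n => x ^- n.+1 end.

Lemma expgz_sub x (m n : nat) :
  expgz x (m%:Z - n%:Z)%R = x ^+ m * x ^- n.
Proof.
case: (leqP n m) => [le|lt].
  by rewrite subzn // /= expgnFr.
have -> : (m%:Z - n%:Z)%R = Negz (n - m).-1 by lia.
rewrite /= prednK ?subn_gt0 // expgnFr ?(ltnW lt) // invgF.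
by [].
Qed.

Lemma int_subn (z : int) : exists m n : nat, z = (m%:Z - n%:Z)%R.
Proof. by case: z => n; [exists n, 0%N|exists 0%N, n.+1]; lia. Qed.

Lemma expgzD x (i j : int) : expgz x (i + j)%R = expgz x i * expgz x j.
Proof.
have [m [n ->]] := int_subn i; have [m' [n' ->]] := int_subn j.
have -> : (m%:Z - n%:Z + (m'%:Z - n'%:Z))%R = ((m + m')%N%:Z - (n' + n)%N%:Z)%R by lia.
rewrite !expgz_sub !expgnDr invgM -!mulgA; congr (_ * _); rewrite !mulgA; congr (_ * _).
exact/commuteV/commuteX2/commute_refl.
Qed.

Lemma expgzN x (i : int) : expgz x (- i)%R = (expgz x i)^-1.
Proof. by apply/esym/mulg1_eq; rewrite -expgzD GRing.subrr. Qed.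

Lemma expgz_in H x z : is_subgroup H -> H x -> H (expgz x z).
Proof.
move=> sH Hx; case: z => n /=; first by apply: subgroupX.
by apply: subgroupV => //; apply: subgroupX.
Qed.

Lemma generated1P x y : generated [set x] y -> exists z, y = expgz x z.
Proof.
apply: (generated_min (H := [set y | exists z, y = expgz x z])); last first.
  by move=> _ ->; exists 1%R.
split; first by exists 0%R.
by move=> _ _ [i ->] [j ->]; exists (i - j)%R; rewrite expgzD expgzN.
Qed.

Lemma commute_expgz x (i j : int) : commute (expgz x i) (expgz x j).
Proof. by rewrite /commute -!expgzD GRing.addrC. Qed.

Definition eqmod H x y : Prop := H (x^-1 * y).

Lemma eqmod_refl H x : is_subgroup H -> eqmod H x x.
Proof. by move=> sH; rewrite /eqmod mulVg; apply: subgroup1. Qed.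

Lemma eqmod_sym H x y : is_subgroup H -> eqmod H x y -> eqmod H y x.
Proof.
by move=> sH /(subgroupV sH); rewrite /eqmod invgM invgK.
Qed.

Lemma eqmod_trans H x y z : is_subgroup H ->
  eqmod H x y -> eqmod H y z -> eqmod H x z.
Proof.
by move=> sH xy /(subgroupM sH xy); rewrite -mulgA mulVKg.
Qed.

Lemma eqmod_in H K x y : is_subgroup K -> H `<=` K ->
  eqmod H x y -> K x -> K y.
Proof. by move=> sK HK /HK xy /subgroupM-/(_ _ sK xy); rewrite mulVKg. Qed.

Section LowerCentralSeries.

Variables (P : set G) (sP : is_subgroup P).

(** Taken relative to a subgroup [P], to serve both for the whole group and for a subgroup of the
    group of sequences. *)
Fixpoint lcs (n : nat) : set G :=
  if n is m.+1 then
    generated [set z | exists x y, [/\ lcs m x, P y & z = [~ x, y]]]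
  else P.

Lemma lcs_subgroup n : is_subgroup (lcs n).
Proof. by case: n => [|n] //=; apply: generated_subgroup. Qed.

Lemma lcs_comm n x p : lcs n x -> P p -> lcs n.+1 [~ x, p].
Proof. by move=> nx Pp; apply: sub_generated; exists x, p. Qed.

Lemma lcsS n : lcs n.+1 `<=` lcs n.
Proof.
elim: n => [|n IH]; apply: generated_min (lcs_subgroup _) _ => _ [x [y [nx Py ->]]].
  exact: subgroupR.
by apply: lcs_comm Py; apply: IH.
Qed.

Lemma lcs_sub n : lcs n `<=` P.
Proof. by elim: n => [|n IH] // x /lcsS/IH. Qed.

Lemma lcsJ n x p : lcs n x -> P p -> lcs n (x ^ p).
Proof.
move=> nx Pp; rewrite -[x ^ p](mulVKg x) -commgEl.
by apply: (subgroupM (lcs_subgroup n) nx); apply: lcsS; apply: lcs_comm.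
Qed.

Lemma eqmodM n x x' y y' : P y ->
  eqmod (lcs n) x x' -> eqmod (lcs n) y y' -> eqmod (lcs n) (x * y) (x' * y').
Proof.
move=> Py xx' yy'; rewrite /eqmod invgM.
have -> : y^-1 * x^-1 * (x' * y') = (x^-1 * x') ^ y * (y^-1 * y').
  by rewrite conjgE -!mulgA mulVKg.
by apply: (subgroupM (lcs_subgroup n)) => //; apply: lcsJ.
Qed.

Lemma eqmodX n x x' k : P x -> eqmod (lcs n) x x' -> eqmod (lcs n) (x ^+ k) (x' ^+ k).
Proof.
move=> Px xx'; elim: k => [|k IH]; first exact: (eqmod_refl _ (lcs_subgroup _)).
by rewrite !expgS; apply: eqmodM => //; apply: subgroupX.
Qed.

Lemma eqmodC n x p : lcs n x -> P p -> eqmod (lcs n.+1) (p * x) (x * p).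
Proof.
move=> nx Pp; rewrite /eqmod.
have -> : (p * x)^-1 * (x * p) = [~ x, p] by rewrite /commg /conjg !groupE.
exact: lcs_comm.
Qed.

(** Conjugation by [v] is trivial modulo the next term, so [uv, p] = [u, p]^v [v, p] becomes a
    product. Together with [commMr] it makes the commutator bilinear modulo term n + 2. *)
Lemma commMl n u v p : lcs n u -> lcs n v -> P p ->
  eqmod (lcs n.+2) [~ u * v, p] ([~ u, p] * [~ v, p]).
Proof.
move=> nu nv Pp; have Pv := lcs_sub nv.
have -> : [~ u * v, p] = [~ u, p] ^ v * [~ v, p].
  by rewrite /commg /conjg !groupE.
apply: eqmodM; last exact: (eqmod_refl _ (lcs_subgroup _)).
  by apply: (@lcs_sub n.+1); apply: lcs_comm.
apply: (eqmod_sym (lcs_subgroup _)).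
by rewrite /eqmod -commgEl; apply: lcs_comm Pv; apply: lcs_comm.
Qed.

Lemma commMr n u p q : lcs n u -> P p -> P q ->
  eqmod (lcs n.+2) [~ u, p * q] ([~ u, p] * [~ u, q]).
Proof.
move=> nu Pp Pq.
have -> : [~ u, p * q] = [~ u, q] * [~ u, p] ^ q.
  by rewrite /commg /conjg !groupE.
have np := lcs_comm nu Pp; have nq := lcs_comm nu Pq.
apply: (@eqmod_trans _ _ ([~ u, q] * [~ u, p]) _ (lcs_subgroup _)).
  apply: eqmodM (eqmod_refl _ (lcs_subgroup _)) _.
    by apply: (@lcs_sub n.+1); apply: lcsJ.
  apply: (eqmod_sym (lcs_subgroup _)).
  by rewrite /eqmod -commgEl; apply: lcs_comm.
by apply: eqmodC => //; apply: lcs_sub nq.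
Qed.

Lemma commXl n u p k : lcs n u -> P p ->
  eqmod (lcs n.+2) [~ u ^+ k, p] ([~ u, p] ^+ k).
Proof.
move=> nu Pp; have sn := lcs_subgroup n.+2.
elim: k => [|k IH]; first by rewrite comm1g; apply: eqmod_refl.
rewrite !expgS; apply: (eqmod_trans sn (commMl nu _ Pp)).
  by apply: subgroupX => //; apply: lcs_subgroup.
apply: eqmodM (eqmod_refl _ sn) IH; apply: subgroupR => //.
  by apply: subgroupX => //; apply: lcs_sub nu.
Qed.

Lemma commXr n u p k : lcs n u -> P p ->
  eqmod (lcs n.+2) [~ u, p ^+ k] ([~ u, p] ^+ k).
Proof.
move=> nu Pp; have sn := lcs_subgroup n.+2; have Pu := lcs_sub nu.
elim: k => [|k IH]; first by rewrite commg1; apply: eqmod_refl.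
rewrite !expgS; apply: (eqmod_trans sn (commMr nu Pp _)).
  by apply: subgroupX => //; apply: lcs_subgroup.
by apply: eqmodM (eqmod_refl _ sn) IH; apply: subgroupR => //; apply: subgroupX.
Qed.

Lemma comm_eqmodl n u u' p : lcs n u -> P p ->
  eqmod (lcs n.+1) u u' -> eqmod (lcs n.+2) [~ u, p] [~ u', p].
Proof.
move=> nu Pp uu'; have sn := lcs_subgroup n.+2.
rewrite -[u'](mulVKg u); set c := u^-1 * u' in uu' *.
apply: (eqmod_sym sn); apply: (eqmod_trans sn (commMl nu (lcsS uu') Pp)).
apply: (eqmod_sym sn); rewrite /eqmod mulKg; exact: lcs_comm.
Qed.

Definition simple_comm p (s : seq G) : G := foldl (fun u q => [~ u, q]) p s.

Lemma simple_comm_rcons p s q : simple_comm p (rcons s q) = [~ simple_comm p s, q].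
Proof. by rewrite /simple_comm -cats1 foldl_cat. Qed.

Lemma simple_comm_lcs p s : P p -> {in s, forall q, P q} ->
  lcs (size s) (simple_comm p s).
Proof.
move=> Pp; elim/last_ind: s => [|s q IH] // Ps.
rewrite simple_comm_rcons size_rcons; apply: lcs_comm.
  by apply: IH => r rs; apply: Ps; rewrite mem_rcons inE rs orbT.
by apply: Ps; rewrite mem_rcons inE eqxx.
Qed.

(** Bilinearity, one entry at a time. All exponents collect in a single one, which can afterwards be
    moved onto any chosen entry. *)
Lemma simple_commX p e (s : seq (G * nat)) : P p -> {in s, forall q, P q.1} ->
  eqmod (lcs (size s).+1) (simple_comm (p ^+ e) [seq q.1 ^+ q.2 | q <- s])
    (simple_comm p [seq q.1 | q <- s] ^+ (e * \prod_(q <- s) q.2)).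
Proof.
move=> Pp; elim/last_ind: s => [|s [q k] IH] Ps.
  by rewrite big_nil muln1; exact: (eqmod_refl _ (lcs_subgroup _)).
have Pq : P q by apply: (Ps (q, k)); rewrite mem_rcons inE eqxx.
have {}Ps : {in s, forall q, P q.1}.
  by move=> r rs; apply: Ps; rewrite mem_rcons inE rs orbT.
rewrite !map_rcons !simple_comm_rcons size_rcons big_rcons /=.
have sn := lcs_subgroup (size s).+2.
have s1 : lcs (size s) (simple_comm (p ^+ e) [seq q.1 ^+ q.2 | q <- s]).
  rewrite -(size_map (fun q => q.1 ^+ q.2) s); apply: simple_comm_lcs.
    by apply: subgroupX.
  by move=> _ /mapP[r /Ps Pr ->]; apply: subgroupX.
have s2 : lcs (size s) (simple_comm p [seq q.1 | q <- s]).
  rewrite -(size_map (fun q => q.1) s); apply: simple_comm_lcs => //.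
  by move=> _ /mapP[r /Ps Pr ->].
apply: (eqmod_trans sn (comm_eqmodl s1 (subgroupX k sP Pq) (IH Ps))).
apply: (eqmod_trans sn (commXl _ s2 (subgroupX k sP Pq))).
rewrite mulnA [(_ * k)%N]mulnC [_ ^+ (k * _)]expgnA; apply: eqmodX.
  by apply: subgroupR => //; [exact: lcs_sub s2|apply: subgroupX].
exact: commXr.
Qed.

(** By bilinearity the [u] with [[~ u, q]] in [Q] form a subgroup, and so do the [q] for fixed [u];
    it is enough to test generators in each entry. Any property that defines a subgroup, such as
    sublinearity or torsion, can be used as [Q]. *)
Lemma lcs_generated X Q n : P = generated X -> is_subgroup Q -> lcs n.+1 `<=` Q ->
  (forall p s, X p -> {in s, forall q, X q} -> size s = n -> Q (simple_comm p s)) ->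
  lcs n `<=` Q.
Proof.
move=> PX; have XP q : X q -> P q by rewrite PX; apply: sub_generated.
elim: n Q => [|n IH] Q sQ nQ XQ.
  by rewrite /= PX; apply: generated_min => // p Xp; apply: (XQ p [::]).
apply: generated_min => // _ [u [p [nu Pp ->]]].
have sn := lcs_subgroup n.
pose Ql q := [set u | lcs n u /\ Q [~ u, q]].
have sQl q : P q -> is_subgroup (Ql q).
  move=> Pq; split.
    by split; [exact: subgroup1|rewrite comm1g; apply: subgroup1].
  move=> x y [nx Qx] [ny Qy]; have nxy := sn.2 _ _ nx ny; split=> //.
  (* Applied to [(x / y) * y], the product rule compares [x, q] with [x / y, q] [y, q] and so
     handles inverses as well. *)
  have := commMl nxy ny Pq; rewrite mulgVK => /eqmod_in-/(_ _ sQ nQ Qx).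
  by move=> /sQ.2-/(_ _ Qy); rewrite mulgK.
have lQl q : X q -> lcs n `<=` Ql q.
  move=> Xq; apply: IH => [||r s Xr Xs sz]; first exact/sQl/XP.
    by move=> v nv; split; [exact: lcsS|apply: nQ; apply: lcs_comm (XP _ Xq)].
  split; first by rewrite -sz; apply: simple_comm_lcs; [exact: XP|move=> t /Xs/XP].
  rewrite -simple_comm_rcons; apply: XQ => //; last by rewrite size_rcons sz.
  by move=> t; rewrite mem_rcons inE => /orP[/eqP->|/Xs].
suff : P `<=` [set q | P q /\ Q [~ u, q]] by move=> /(_ _ Pp)[].
rewrite {1}PX; apply: generated_min => [|q Xq]; last first.
  by split; [exact: XP|have [] := lQl _ Xq _ nu].
split; first by split; [exact: subgroup1|rewrite commg1; apply: subgroup1].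
move=> x y [Px Qx] [Py Qy]; have Pxy := sP.2 _ _ Px Py; split=> //.
have := commMr nu Pxy Py; rewrite mulgVK => /eqmod_in-/(_ _ sQ nQ Qx).
by move=> /sQ.2-/(_ _ Qy); rewrite mulgK.
Qed.

End LowerCentralSeries.

Lemma lower_central_series_lcs n : lower_central_series n = lcs [set: G] n.
Proof.
elim: n => //= n ->; congr generated; apply/seteqP; split=> z [x [y]].
  by move=> [nx ->]; exists x, y.
by move=> [nx _ ->]; exists x, y.
Qed.

End Subgroups.

Arguments lcs : simpl never.

(** * Word length *)

Section WordLength.

Variables (G : groupType) (S : {fset G}).
Hypothesis genS : generating_set S.

Local Notation len := (word_length S).

Lemma eval_cat (u v : seq S) : eval_word (u ++ v) = eval_word u * eval_word v.
Proof. by rewrite /eval_word big_cat. Qed.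

Lemma eval_nil : eval_word ([::] : seq S) = 1.
Proof. by rewrite /eval_word big_nil. Qed.

Lemma eval_cons s (v : seq S) : eval_word (s :: v) = val s * eval_word v.
Proof. by rewrite /eval_word big_cons. Qed.

Lemma eval_nseq n (s : S) : eval_word (nseq n s) = val s ^+ n.
Proof.
by elim: n => [|n IH]; rewrite /= ?eval_nil // eval_cons IH expgS.
Qed.

Lemma inverse_word (w : seq S) :
  exists w' : seq S, size w' = size w /\ eval_word w' = (eval_word w)^-1.
Proof.
elim: w => [|s w [w' [sz ev]]]; first by exists [::]; rewrite eval_nil invg1.
exists (w' ++ [:: [` genS.1 _ (valP s)]%fset]).
by rewrite size_cat sz addn1 eval_cat !eval_cons eval_nil mulg1 ev invgM.
Qed.

Lemma word_exists g : exists w : seq S, eval_word w = g.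
Proof.
have : generated [set` S] g by rewrite genS.2.
apply: (generated_min (H := [set g | exists w : seq S, eval_word w = g])).
  split; first by exists [::]; rewrite eval_nil.
  move=> _ _ [u <-] [v <-]; have [v' [_ <-]] := inverse_word v.
  by exists (u ++ v'); rewrite eval_cat.
by move=> s sS; exists [:: [` sS]%fset]; rewrite eval_cons eval_nil mulg1.
Qed.

Lemma word_lengthP g : has_word_of_size S g (len g) /\
  forall n, has_word_of_size S g n -> len g <= n.
Proof.
rewrite /word_length; case: pselect => [ex|nex].
  by case: ex_minnP => m /asboolP hm min; split=> // n hn; apply/min/asboolP.
by have [w ew] := word_exists g; case: nex; exists (size w); apply/asboolP; exists w.
Qed.

Lemma geodesic_word g : exists w : seq S, size w = len g /\ eval_word w = g.
Proof. by have [] := word_lengthP g. Qed.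

Lemma len_eval (w : seq S) : len (eval_word w) <= size w.
Proof. by have [_] := word_lengthP (eval_word w); apply; exists w. Qed.

Lemma len1 : len 1 = 0.
Proof. by apply/eqP; rewrite -leqn0 -eval_nil; apply: len_eval. Qed.

Lemma lenM g h : len (g * h) <= len g + len h.
Proof.
have [u [<- <-]] := geodesic_word g; have [v [<- <-]] := geodesic_word h.
by rewrite -eval_cat -size_cat len_eval.
Qed.

Lemma lenV g : len g^-1 = len g.
Proof.
have le x : len x^-1 <= len x.
  have [u [<- <-]] := geodesic_word x; have [v [<- <-]] := inverse_word u.
  exact: len_eval.
by apply/eqP; rewrite eqn_leq le -{1}[g]invgK le.
Qed.

Lemma lenX g n : len (g ^+ n) <= (n * len g)%N.
Proof.
elim: n => [|n IH]; first by rewrite len1.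
by rewrite expgS mulSn; apply: leq_trans (lenM _ _) _; rewrite leq_add2l.
Qed.

Lemma lenR g h : len [~ g, h] <= (2 * len g + 2 * len h)%N.
Proof.
have := lenM g h; have := lenM h^-1 (g * h); have := lenM g^-1 (g ^ h).
rewrite !lenV commgEl conjgE.
move: (len (g^-1 * _)) (len (h^-1 * _)) (len (g * h)) => l1 l2 l3; lia.
Qed.

End WordLength.

(** * Conjugation by large powers is sublinear in nilpotent groups *)

Section Sequences.

Variable G : groupType.

(** The direct power of G over the naturals, under a name of its own to which the pointwise group
    structure can be attached. *)
Definition sequence : Type := nat -> G.

HB.instance Definition _ := Choice.copy sequence (nat -> G).

Let mul (x y : sequence) : sequence := fun n => x n * y n.
Let one : sequence := fun=> 1.
Let inv (x : sequence) : sequence := fun n => (x n)^-1.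

Fact sequence_mulA : associative mul.
Proof. by move=> x y z; apply/funext => n; rewrite /mul mulgA. Qed.

Fact sequence_mul1g : left_id one mul.
Proof. by move=> x; apply/funext => n; rewrite /mul mul1g. Qed.

Fact sequence_mulg1 : right_id one mul.
Proof. by move=> x; apply/funext => n; rewrite /mul mulg1. Qed.

Fact sequence_mulVg : left_inverse one inv mul.
Proof. by move=> x; apply/funext => n; rewrite /mul mulVg. Qed.

Fact sequence_mulgV : right_inverse one inv mul.
Proof. by move=> x; apply/funext => n; rewrite /mul mulgV. Qed.

HB.instance Definition _ := isGroup.Build sequence sequence_mulA
  sequence_mul1g sequence_mulg1 sequence_mulVg sequence_mulgV.

Lemma sequenceM (x y : sequence) n : (x * y) n = x n * y n.
Proof. by []. Qed.

Lemma sequenceX (x : sequence) k n : (x ^+ k) n = x n ^+ k.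
Proof. by elim: k => // k IH; rewrite !expgS sequenceM IH. Qed.

End Sequences.

Section Sublinear.

Variables (G : groupType) (S : {fset G}) (a : G).
Hypothesis genS : generating_set S.

Local Notation len := (word_length S).
Local Notation seqG := (sequence G).

(* Sublinear along a cofinal system of multiples: this is a subgroup, and it
   is insensitive to the rescalings [rescale t] below. *)
Definition sublinear : set seqG := [set x | forall k, exists M n0, 0 < M /\
  forall n, (n0 <= n -> k * len (x (M * n)) <= M * n)%N].

Definition rescale (t : nat) (x : seqG) : seqG := fun n => x (t * n)%N.

Definition powers : seqG := fun n => a ^+ n.

(** On these sequences [rescale t] acts by powers: it sends [powers] to its [t]-th power and fixes
    the constants. *)
Definition scale_generators : set seqG := [set x | x = powers \/ exists g, x = fun=> g].

Definition scale_group : set seqG := generated scale_generators.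

Local Notation gamma := (lcs scale_group).

Lemma sublinear_subgroup : is_subgroup sublinear.
Proof.
split; first by move=> k; exists 1%N, 0%N; split=> // n _; rewrite len1 ?muln0.
move=> x y sx sy k; have [M1 [n1 [M1pos H1]]] := sx (2 * k)%N.
have [M2 [n2 [M2pos H2]]] := sy (2 * k)%N.
exists (M1 * M2)%N, (maxn n1 n2); split=> [|n]; first by rewrite muln_gt0 M1pos.
rewrite geq_max => /andP[le1 le2].
have {}H1 := H1 (M2 * n)%N; have {}H2 := H2 (M1 * n)%N.
rewrite mulnA in H1; rewrite mulnCA mulnA in H2.
have {}H1 : (2 * k * len (x (M1 * M2 * n)) <= M1 * M2 * n)%N by apply: H1; nia.
have {}H2 : (2 * k * len (y (M1 * M2 * n)) <= M1 * M2 * n)%N by apply: H2; nia.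
have := lenM genS (x (M1 * M2 * n)%N) (y (M1 * M2 * n)%N)^-1; rewrite lenV //.
rewrite -[(x / y) _]/(x _ / y _) => /(leq_mul (leqnn k)); nia.
Qed.

Lemma sublinear_const g : sublinear (fun=> g).
Proof. by move=> k; exists 1%N, (k * len g)%N; split=> // n; rewrite mul1n. Qed.

(** Since [C] does not depend on [t], the length of [x] along the multiples of [t] has slope about C
    / t, and [t] can be taken arbitrarily large. *)
Lemma sublinear_rescale (x : seqG) C :
  (forall t, exists (y e : seqG) c, [/\ rescale t x = y * e, sublinear e &
     forall n, (len (y n) <= C * n + c)%N]) ->
  sublinear x.
Proof.
(* In [C.+1] the extra unit absorbs the error [e], used below with slope 1; the outer successor
   absorbs the constant [k * c]. *)
move=> H k; set t := ((2 * k * C.+1).+1)%N; have [y [e [c [xye se ly]]]] := H t.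
have [M [n0 [Mpos He]]] := se 1%N; exists (t * M)%N, (maxn n0 (k * c)).
split=> [|n]; first by rewrite muln_gt0.
rewrite geq_max => /andP[le0 lec]; have {}He := He n le0; have {}ly := ly (M * n)%N.
have -> : x (t * M * n)%N = y (M * n)%N * e (M * n)%N.
  by rewrite -sequenceM -xye /rescale mulnA.
have := lenM genS (y (M * n)%N) (e (M * n)%N); rewrite mul1n in He.
move=> le; apply: (@leq_trans (k * (C.+1 * (M * n) + c))%N).
  by rewrite leq_mul2l; apply/orP; right; lia.
rewrite mulnDr -mulnA /t mulSn; have : (n <= M * n)%N by rewrite leq_pmull.
nia.
Qed.

(** A commutator with a new entry turns a slope s into 2 s + 2 D, which is at most 4 s when s is at
    least D. *)
Lemma simple_comm_linear D p (s : seq seqG) :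
  (forall q, q \in p :: s -> exists c, forall n, (len (q n) <= D * n + c)%N) ->
  exists c, forall n, (len (simple_comm p s n) <= D * 4 ^ size s * n + c)%N.
Proof.
elim/last_ind: s => [|s q IH] H.
  have [c Hc] := H p (mem_head _ _); exists c => n.
  by rewrite muln1; apply: Hc.
have [|c Hc] := IH.
  by move=> r rs; apply: H; rewrite -rcons_cons mem_rcons inE rs orbT.
have [|c' Hc'] := H q; first by rewrite -rcons_cons mem_rcons mem_head.
exists (2 * c + 2 * c')%N => n; rewrite simple_comm_rcons size_rcons.
have := lenR genS (simple_comm p s n) (q n); rewrite expnS.
rewrite -[[~ simple_comm p s, q] n]/[~ simple_comm p s n, q n].
have := Hc n; have := Hc' n; have : (0 < 4 ^ size s)%N by rewrite expn_gt0.
move: (4 ^ _)%N => f; nia.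
Qed.

Lemma rescale_simple_comm t p s :
  rescale t (simple_comm p s) = simple_comm (rescale t p) (map (rescale t) s).
Proof. by elim/last_ind: s => // s q IH; rewrite map_rcons !simple_comm_rcons -IH. Qed.

(* Rescaling by [t] multiplies a simple commutator by a power of [t] modulo the
   next term; by multilinearity the whole power can be moved onto a constant
   entry, and this keeps the growth rate independent of [t]. *)
Lemma sublinear_simple_comm p q s :
  scale_generators p -> {in q :: s, forall r, scale_generators r} ->
  gamma (size s).+2 `<=` sublinear -> sublinear (simple_comm p (q :: s)).
Proof.
move=> Xp Xs IH; pose D := len a.
have sP : is_subgroup scale_group := generated_subgroup _.
have XP r : scale_generators r -> scale_group r by apply: sub_generated.
have lin r : scale_generators r -> exists c, forall n, (len (r n) <= D * n + c)%N.
  move=> [->|[g ->]]; last by exists (len g) => n; apply: leq_addl.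
  by exists 0 => n; rewrite addn0 mulnC; apply: lenX.
have linX g e : exists c, forall n, (len ((((fun=> g) : seqG) ^+ e)%g n) <= D * n + c)%N.
  by exists (len (g ^+ e)) => n; rewrite sequenceX; apply: leq_addl.
pose ones l : seq (seqG * nat) := [seq (r, 1%N) | r <- l].
have ones1 l : [seq r.1 | r <- ones l] = l.
  by rewrite -map_comp; apply: map_id.
have onesX l : [seq r.1 ^+ r.2 | r <- ones l] = l.
  by rewrite -map_comp; apply: map_id.
have ones_prod l : (\prod_(r <- ones l) r.2)%N = 1%N by rewrite big_map big1.
have Xones l : {in l, forall r, scale_generators r} ->
    {in ones l, forall r, scale_group r.1}.
  by move=> Xl _ /mapP[r /Xl/XP Pr ->].
set x := simple_comm p (q :: s).
pose C := (D * 4 ^ (size s).+1)%N.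
(* [Y E] represents [x ^+ E] modulo the next term, with the same slope [C] for every [E]. The
   rescaled [x] is such a power up to an error that is sublinear by [IH]. *)
suff [Y HY] : exists Y : nat -> seqG, forall E,
    eqmod (gamma (size s).+2) (Y E) (x ^+ E) /\
    exists c, forall n, (len (Y E n) <= C * n + c)%N.
  apply: (@sublinear_rescale _ C) => t.
  pose e r := if r == powers then t else 1%N.
  have resE r : scale_generators r -> rescale t r = r ^+ e r.
    rewrite /e; case: eqP => [-> _|npow [//|[g ->]]]; last by rewrite expg1.
    by apply/funext => n; rewrite sequenceX /rescale /powers mulnC expgnA.
  have := simple_commX sP (e p) (s := [seq (r, e r) | r <- q :: s]) (XP p Xp).
  set E := (_ * _)%N => xE.
  have pairs1 : [seq r.1 | r <- [seq (r, e r) | r <- q :: s]] = q :: s.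
    by rewrite -map_comp; apply: map_id.
  rewrite pairs1 size_map in xE.
  have {}xE : eqmod (gamma (size s).+2) (rescale t x) (x ^+ E).
    have -> : rescale t x = simple_comm (p ^+ e p)
        [seq r.1 ^+ r.2 | r <- [seq (r, e r) | r <- q :: s]].
      rewrite rescale_simple_comm resE // -map_comp; congr simple_comm.
      by apply/eq_in_map => r /Xs/resE.
    by apply: xE => _ /mapP[r /Xs/XP Pr ->].
  have [YE [c Hc]] := HY E.
  exists (Y E), ((Y E)^-1 * rescale t x), c; split=> //; first by rewrite mulVKg.
  have sg := lcs_subgroup sP (size s).+2.
  exact: IH _ (eqmod_trans sg YE (eqmod_sym sg xE)).
(* A constant among the first two entries takes the exponent [E] without changing the slope. If both
   entries are [powers], they commute and [x] is trivial. *)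
have [pow_p|npow_p] := eqVneq p powers; last first.
  exists (fun E => simple_comm (p ^+ E) (q :: s)) => E; split.
    have := simple_commX sP E (XP _ Xp) (Xones _ Xs).
    by rewrite onesX ones1 ones_prod muln1 size_map.
  apply: simple_comm_linear => r; rewrite inE => /orP[/eqP->|/Xs/lin //].
  case: Xp => [pE|[g ->]]; last exact: linX.
  by rewrite pE eqxx in npow_p.
have [pow_q|npow_q] := eqVneq q powers; last first.
  have Xq : scale_generators q by apply: Xs; rewrite mem_head.
  have {}Xs : {in s, forall r, scale_generators r}.
    by move=> r rs; apply: Xs; rewrite inE rs orbT.
  exists (fun E => simple_comm p (q ^+ E :: s)) => E; split.
    have := @simple_commX _ _ sP p 1 ((q, E) :: ones s) (XP _ Xp).
    rewrite /= onesX ones1 big_cons ones_prod muln1 mul1n size_map; apply.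
    by move=> r; rewrite inE => /orP[/eqP-> /=|/(Xones _ Xs) //]; apply: XP.
  apply: simple_comm_linear => r; rewrite !inE => /or3P[/eqP->|/eqP->|/Xs/lin //].
    exact: lin.
  case: Xq => [qE|[g ->]]; last exact: linX.
  by rewrite qE eqxx in npow_q.
suff x1 : x = 1.
  exists (fun=> 1) => E; split.
    by rewrite x1 expg1n; exact: (eqmod_refl _ (lcs_subgroup sP _)).
  by exists 0%N => n; rewrite -[(1 : seqG) n]/(1 : G) len1.
rewrite /x /simple_comm /= pow_p pow_q commgg.
by elim: (s) => //= r l; rewrite comm1g.
Qed.

(** Descending induction along the series, which becomes trivial pointwise at the class of G. It
    stops at term 1, because term 0 contains [powers] itself. *)
Lemma lcs_sublinear : nilpotent_group G -> gamma 1 `<=` sublinear.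
Proof.
move=> [c nil]; have sP : is_subgroup scale_group := generated_subgroup _.
have pointwise n (x : seqG) : gamma n x -> forall k, lower_central_series n (x k).
  elim: n x => [|n IH] x //= nx k; move: x nx.
  apply: (generated_min (H := [set x : seqG | generated _ (x k)])).
    split; first exact: (generated_subgroup _).1.
    by move=> x y; apply: (generated_subgroup _).2.
  move=> _ [x [y [nx _ ->]]]; apply: sub_generated.
  by exists (x k), (y k); split=> //; apply: IH.
have base : gamma c.+1 `<=` sublinear.
  move=> x /(lcsS sP)/pointwise x1; suff -> : x = fun=> 1 by apply: sublinear_const.
  by apply/funext => k; have := x1 k; rewrite nil.
elim: c {nil} base => [|c IH] // base; apply: IH.
apply: (lcs_generated sP erefl sublinear_subgroup base) => p [|q s] //= Xp Xs [sz].
by apply: sublinear_simple_comm; rewrite ?sz.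
Qed.

(** The conjugate a^m g a^-m is [a^-m, g^-1] g, the value of an element of the first term times a
    constant sequence. *)
Lemma conj_sublinear : nilpotent_group G -> forall g k m0,
  exists m, (m0 <= m)%N /\ (k * len (a ^+ m * g * a ^- m) <= m)%N.
Proof.
move=> nilG g k m0.
have sP : is_subgroup scale_group := generated_subgroup _.
have XP r : scale_generators r -> scale_group r by apply: sub_generated.
pose cg : seqG := fun=> g.
have : sublinear ([~ powers^-1, cg^-1] * cg).
  have g1 : gamma 1 [~ powers^-1, cg^-1].
    apply: lcs_comm; apply: (subgroupV sP); apply: XP; first by left.
    by right; exists g.
  exact: (subgroupM sublinear_subgroup (lcs_sublinear nilG g1) (sublinear_const g)).
move=> /(_ k)[M [n0 [Mpos H]]]; exists (M * maxn n0 m0)%N; split.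
  by rewrite (leq_trans (leq_maxr n0 m0)) // leq_pmull.
have := H _ (leq_maxl n0 m0).
set m := (M * _)%N; rewrite -[(_ * cg) m]/([~ (a ^+ m)^-1, g^-1] * g).
by rewrite /commg /conjg !groupE.
Qed.

End Sublinear.

(** * Virtually cyclic or two independent homomorphisms to the rationals *)

Lemma expgz_muln (G : groupType) (x : G) (i : int) (n : nat) :
  expgz x (i * n%:Z)%R = expgz (x ^+ n) i.
Proof.
have [a [b ->]] := int_subn i; rewrite GRing.mulrBl -!PoszM !expgz_sub.
by rewrite -!expgnA ![(_ * n)%N]mulnC.
Qed.

Section Adjoin.

Variables (G : groupType) (H : set G) (t : G).
Hypothesis sH : is_subgroup H.
Hypothesis nH : forall h k, H h -> H (h ^ expgz t k).

Definition adjoin : set G := [set g | exists h k, H h /\ g = h * expgz t k].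

Lemma adjoin_subgroup : is_subgroup adjoin.
Proof.
split; first by exists 1, 0%R; split; [exact: subgroup1|rewrite mulg1].
move=> _ _ [h [i [Hh ->]]] [h' [j [Hh' ->]]].
exists (h * (h'^-1) ^ expgz t (j - i)%R), (i - j)%R; split.
  by apply: (subgroupM sH) => //; apply: nH; apply: subgroupV.
by rewrite conjgE -expgzN GRing.opprB !expgzD !expgzN !groupE.
Qed.

Lemma sub_adjoin : H `<=` adjoin.
Proof. by move=> h Hh; exists h, 0%R; rewrite mulg1. Qed.

Lemma mem_adjoin : adjoin t.
Proof. by exists 1, 1%R; split; [exact: subgroup1|rewrite mul1g]. Qed.

End Adjoin.

Lemma normalJ (G : groupType) (P H : set G) x p : is_subgroup H ->
  (forall x y, P x -> P y -> H [~ x, y]) -> H x -> P x -> P p -> H (x ^ p).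
Proof.
move=> sH abH Hx Px Pp; rewrite -[x ^ p](mulVKg x) -commgEl.
by apply: subgroupM => //; apply: abH.
Qed.

(** * Extending homomorphisms to the rationals *)

Section Homomorphisms.

Import GRing.Theory.

Variable G : groupType.

Definition additive_on (H : set G) (f : G -> rat) : Prop :=
  forall x y, H x -> H y -> f (x * y) = (f x + f y)%R.

Lemma additive1 H f : is_subgroup H -> additive_on H f -> f 1 = 0%R.
Proof.
move=> sH fH; have H1 := subgroup1 sH; apply: (addrI (f 1)).
by rewrite -fH // mulg1 addr0.
Qed.

Lemma additiveV H f x : is_subgroup H -> additive_on H f -> H x -> f x^-1 = (- f x)%R.
Proof.
move=> sH fH Hx; apply: (addrI (f x)); rewrite -fH //; last exact: subgroupV.
by rewrite mulgV (additive1 sH fH) subrr.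
Qed.

Lemma additiveX H f x n : is_subgroup H -> additive_on H f -> H x ->
  f (x ^+ n) = (f x *+ n)%R.
Proof.
move=> sH fH Hx; elim: n => [|n IH]; first by rewrite (additive1 sH fH) mulr0n.
by rewrite expgS mulrS -IH fH //; apply: subgroupX.
Qed.

(** This is one step of the injectivity of the rationals. [H] contains all commutators, hence is
    normal, and [f] kills them, hence is invariant under conjugation. *)
Lemma extend_additive (H : set G) (f : G -> rat) (t : G) :
  is_subgroup H -> (forall x y, H [~ x, y]) -> additive_on H f ->
  (forall x y, f [~ x, y] = 0%R) ->
  exists f', [/\ additive_on (adjoin H t) f', {in H, f' =1 f} &
    (forall n, 0 < n -> ~ H (t ^+ n))%N -> f' t = 1%R].
Proof.
move=> sH abH fH f0.
have nH h k : H h -> H (h ^ expgz t k).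
  by move=> Hh; apply: (@normalJ _ [set: G]).
(* The value to give to [t]: it is forced to be f(t^n) / n if some power t^n with n > 0 lies in [H],
   and is free, here 1, otherwise. *)
have [c [cP c1]] : exists c : rat,
    (forall n, H (t ^+ n) -> f (t ^+ n) = (n%:R * c)%R) /\
    ((forall n, 0 < n -> ~ H (t ^+ n))%N -> c = 1%R).
  have [[n [n0 Hn]]|none] := pselect (exists n, (0 < n)%N /\ H (t ^+ n)).
    exists (f (t ^+ n)%g / n%:R)%R; split; last by move=> /(_ n n0).
    move=> m Hm; have n0' : (n%:R != 0 :> rat)%R by rewrite Num.Theory.pnatr_eq0 -lt0n.
    apply: (mulIf n0'); rewrite mulrA divfK // mulr_natl mulr_natr.
    by rewrite -!(additiveX _ sH fH) // -!expgnA mulnC.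
  exists 1%R; split=> // -[|m] Hm; first by rewrite mul0r (additive1 sH fH).
  by case: none; exists m.+1.
have {}cP k : H (expgz t k) -> f (expgz t k) = (k%:~R * c)%R.
  case: k => n /=; first exact: cP.
  move=> Hn; have Hn' : H (t ^+ n.+1) by rewrite -[_ ^+ _]invgK; apply: subgroupV.
  by rewrite (additiveV sH fH) // cP // NegzE mulrNz mulNr.
pose dec g := xget (1, 0%R) [set p : G * int | H p.1 /\ g = p.1 * expgz t p.2].
have decP g : adjoin H t g -> H (dec g).1 /\ g = (dec g).1 * expgz t (dec g).2.
  move=> [h [k hk]]; rewrite /dec.
  apply: (@xgetPex _ _ [set p : G * int | H p.1 /\ g = p.1 * expgz t p.2]).
  by exists (h, k).
pose f' g := (f (dec g).1 + (dec g).2%:~R * c)%R.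
have f'E h k : H h -> f' (h * expgz t k) = (f h + k%:~R * c)%R.
  move=> Hh; rewrite /f'; have [] := decP (h * expgz t k); first by exists h, k.
  move: (dec _) => -[h' k'] /= Hh' eq.
  have eq2 : h'^-1 * h = expgz t (k' - k)%R.
    by rewrite expgzD expgzN -(mulgK (expgz t k) h) eq !groupE.
  have Hk : H (expgz t (k' - k)%R)
    by rewrite -eq2; apply: subgroupM => //; apply: subgroupV.
  have -> : f h = (f h' + (k' - k)%:~R * c)%R.
    by rewrite -cP // -fH // -eq2 mulVKg.
  by rewrite -addrA -mulrDl -intrD subrK.
exists f'; split.
- move=> _ _ [h [i [Hh ->]]] [h' [j [Hh' ->]]].
  have -> : h * expgz t i * (h' * expgz t j) =
      h * h' ^ expgz t (- i)%R * expgz t (i + j)%R.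
    by rewrite conjgE expgzD !expgzN !groupE.
  have HhJ : H (h' ^ expgz t (- i)%R) by apply: nH.
  rewrite !f'E //; last exact: subgroupM.
  rewrite fH // -[h' ^ _](mulVKg h') -commgEl fH // f0 addr0.
  by rewrite intrD mulrDl addrACA; congr (_ + _)%R.
- by move=> h Hh; rewrite -[h]mulg1 (f'E h 0%R) ?mulg1 ?mul0r ?addr0 //; apply: set_mem.
- move=> none; rewrite -[t in f' t]mul1g -[t in f' (_ * t)]/(expgz t 1).
  rewrite f'E; last exact: subgroup1.
  by rewrite (additive1 sH fH) add0r mul1r c1.
Qed.

(** Start from the zero map on [H], which contains no positive power of [t], send [t] to 1, and
    adjoin the generators one by one. *)
Lemma exists_additive (S : seq G) (H : set G) (t : G) :
  generated [set` S] = [set: G] ->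
  is_subgroup H -> (forall x y, H [~ x, y]) ->
  (forall n, 0 < n -> ~ H (t ^+ n))%N ->
  exists f : G -> rat, [/\ {morph f : x y / x * y >-> (x + y)%R},
    forall h, H h -> f h = 0%R & f t = 1%R].
Proof.
move=> genS sH abH none.
have nJ K s h k : is_subgroup K -> H `<=` K -> K h -> K (h ^ expgz s k).
  by move=> sK HK Kh; apply: (@normalJ _ [set: G]) => // x y _ _; apply: HK.
have ext (ys : seq G) : exists K f, [/\ is_subgroup K, H `<=` K,
    forall y, y \in t :: ys -> K y, additive_on K f &
    (forall h, H h -> f h = 0%R) /\ f t = 1%R].
  elim: ys => [|y ys [K [f [sK HK ysK fK [f0 f1]]]]].
    have [||f [fK f0 f1]] := @extend_additive H (fun=> 0%R) t sH abH.
    - by move=> x y _ _; rewrite addr0.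
    - by [].
    exists (adjoin H t), f; split=> //.
    + by apply: (adjoin_subgroup sH) => h k; apply: nJ.
    + exact: sub_adjoin.
    + by move=> y; rewrite inE => /eqP->; apply: mem_adjoin.
    + by split; [move=> h Hh; apply/f0/mem_set|exact: f1].
  have [||f' [f'K f'E _]] := @extend_additive K f y sK _ fK.
  - by move=> u v; apply: HK.
  - by move=> u v; apply: f0.
  exists (adjoin K y), f'; split=> //.
  - by apply: (adjoin_subgroup sK) => h k; apply: nJ.
  - by move=> h /HK Kh; apply: sub_adjoin.
  - move=> z; rewrite !inE orbCA => /orP[/eqP->|]; first exact: mem_adjoin.
    by rewrite -in_cons => /ysK; apply: sub_adjoin.
  - split=> [h Hh|]; first by rewrite f'E ?f0 //; apply/mem_set/HK.
    by rewrite f'E //; apply/mem_set/ysK/mem_head.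
have [K [f [sK HK SK fK [f0 f1]]]] := ext S.
have KT : K = [set: G].
  apply/seteqP; split=> // g _; have : generated [set` S] g by rewrite genS.
  by apply: generated_min => // s sS; apply: SK; rewrite inE [s \in S]sS orbT.
by exists f; split=> // x y; apply: fK; rewrite KT.
Qed.

End Homomorphisms.

Section Covering.

Variable G : groupType.
Implicit Types (H K P Q : set G).

(** Finite index in the form of a finite list of left translates of [K], which composes along chains
    without counting cosets. *)
Definition covered H K : Prop :=
  exists F : seq G, forall h, H h -> exists2 f, f \in F & K (f^-1 * h).

Lemma covered_trans H K Q : covered H K -> covered K Q -> covered H Q.
Proof.
move=> [F1 c1] [F2 c2]; exists [seq f1 * f2 | f1 <- F1, f2 <- F2] => h.
move=> /c1[f1 i1 /c2[f2 i2 q]]; exists (f1 * f2); first exact: allpairs_f.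
by rewrite invgM -mulgA.
Qed.

(** A finitely generated abelian torsion group is finite: the torsion generators are adjoined to [K]
    one at a time, each with finitely many cosets. *)
Lemma covered_torsion P K (xs : seq G) : is_subgroup P -> is_subgroup K ->
  K `<=` P -> (forall x y, P x -> P y -> K [~ x, y]) ->
  (forall x, x \in xs -> P x /\ exists n, (0 < n)%N /\ K (x ^+ n)) ->
  P `<=` generated (K `|` [set` xs]) -> covered P K.
Proof.
move=> sP; elim: xs K => [|x xs IH] K sK KP abK tors gen.
  exists [:: 1] => p /gen; rewrite set_nil setU0 => gp.
  exists 1; rewrite ?mem_head // invg1 mul1g.
  by move: p gp; apply: generated_min.
have [Px [n [n0 Kn]]] := tors x (mem_head _ _).
have Pz k : P (expgz x k) by apply: expgz_in.
have nK h k : K h -> K (h ^ expgz x k).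
  by move=> Kh; apply: (@normalJ _ P) => //; apply: KP.
pose K' := adjoin K x; have KK' : K `<=` K' by apply: sub_adjoin.
have sK' : is_subgroup K' by apply: adjoin_subgroup.
apply: (@covered_trans _ K').
  apply: IH => //.
  - by move=> _ [h [k [Kh ->]]]; apply: subgroupM => //; apply: KP.
  - by move=> u v Pu Pv; apply/KK'/abK.
  - move=> y yxs; have [|Py [m [m0 Km]]] := tors y; first by rewrite inE yxs orbT.
    by split=> //; exists m; split=> //; apply: KK'.
  - move=> p /gen; move: p; apply: generated_min (generated_subgroup _) _ => p [Kp|].
      by apply: sub_generated; left; apply: KK'.
    rewrite /= inE => /orP[/eqP->|yxs]; apply: sub_generated; last by right.
    by left; apply: mem_adjoin.
exists [seq x ^+ i | i <- iota 0 n] => _ [h [k [Kh ->]]].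
have n0' : (n%:Z != 0)%R by rewrite eqz_nat -lt0n.
have : (0 <= (k %% n)%Z < n)%R by rewrite modz_ge0 // ltz_pmod.
case rE : (k %% n)%Z => [r|//] /andP[_ rn].
exists (x ^+ r); first by apply: map_f; rewrite mem_iota.
have -> : (x ^+ r)^-1 * (h * expgz x k) =
    h ^ expgz x r * expgz x ((k %/ n)%Z * n)%R.
  rewrite {1}(divz_eq k n) rE GRing.addrC expgzD conjgE -[x ^+ r]/(expgz x r).
  by rewrite !groupE.
apply: subgroupM => //; first exact: nK.
by rewrite expgz_muln; apply: expgz_in.
Qed.


Lemma covered_finite_index (x : G) :
  covered [set: G] (generated [set x]) -> finite_index (generated [set x]).
Proof.
set H := generated _ => -[F cF]; have sH : is_subgroup H by apply: generated_subgroup.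
apply: (@sub_finite_set _ _ [set [set g * h | h in H] | g in [set` F]]); last first.
  exact/finite_image/finite_seq.
move=> _ [g _ <-]; have [f Ff Hfg] := cF g I; exists f => //.
apply/seteqP; split=> _ [h Hh <-].
  exists (g^-1 * f * h); last by rewrite !groupE.
  apply: (subgroupM sH) => //; rewrite -[g^-1 * f]invgK invgM invgK.
  exact: (subgroupV sH).
exists (f^-1 * g * h); last by rewrite !groupE.
exact: (subgroupM sH).
Qed.

End Covering.

(** * Torsion modulo a cyclic subgroup, or two dual homomorphisms *)

Section Dichotomy.

Variables (G : groupType) (S : {fset G}).
Hypothesis genS : generating_set S.

Local Notation gamma := (lcs [set: G]).
Let sT := @subgroup_setT G.

Lemma simple_comm_sub n u (s : seq G) : gamma n u -> gamma (n + size s) (simple_comm u s).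
Proof.
elim/last_ind: s => [|s q IH] nu; first by rewrite addn0.
by rewrite simple_comm_rcons size_rcons addnS; apply: lcs_comm => //; apply: IH.
Qed.

(* If powers of the generators lie in the abelianized cyclic group of [x], then
   by multilinearity simple commutators of weight at least two are torsion
   modulo the next term. *)
Lemma simple_comm_torsion x p q (s : seq G) n1 n2 :
  adjoin (gamma 1) x (p ^+ n1) -> adjoin (gamma 1) x (q ^+ n2) ->
  gamma (size s).+2 (simple_comm p (q :: s) ^+ (n1 * n2)).
Proof.
move=> [c1 [k1 [g1 e1]]] [c2 [k2 [g2 e2]]].
have := @simple_commX _ _ sT p n1 ((q, n2) :: [seq (r, 1%N) | r <- s]) I.
rewrite /= big_cons big_map big1 // muln1 size_map -!map_comp !map_id.
move=> /(_ (fun _ _ => I)) eq; apply: (eqmod_in (lcs_subgroup sT _) _ eq) => //.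
rewrite -add2n; apply: simple_comm_sub.
have e1' : eqmod (gamma 1) (expgz x k1) (p ^+ n1).
  rewrite /eqmod e1 -[_^-1 * _]/(c1 ^ expgz x k1); exact: lcsJ.
have e2' : eqmod (gamma 1) (expgz x k2) (q ^+ n2).
  rewrite /eqmod e2 -[_^-1 * _]/(c2 ^ expgz x k2); exact: lcsJ.
have s2 := lcs_subgroup sT 2.
have comm0 u v w : eqmod (gamma 1) u v -> gamma 2 [~ u, w] -> gamma 2 [~ v, w].
  by move=> /(@comm_eqmodl _ _ sT 0 u v w I I)/(eqmod_in s2 (fun _ h => h)).
apply: (comm0 _ _ _ e1'); rewrite -invgR; apply: (subgroupV s2).
apply: (comm0 _ _ _ e2');
suff -> : [~ expgz x k2, expgz x k1] = 1 by apply: (subgroup1 s2).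
exact/eqP/commgP/commute_expgz.
Qed.

(** The quotient is abelian and is generated by the simple commutators of weight n + 2 in [S], which
    are finite in number and torsion. *)
Lemma covered_lcs x n :
  (forall p, p \in S -> exists k, (0 < k)%N /\ adjoin (gamma 1) x (p ^+ k)) ->
  covered (gamma n.+1) (gamma n.+2).
Proof.
move=> tors; pose comm (t : S * n.+1.-tuple S) := simple_comm (val t.1) (map val t.2).
have sn := lcs_subgroup sT n.+2.
apply: (@covered_torsion _ _ _ (map comm (enum {: S * n.+1.-tuple S}))) => //.
- exact: lcs_subgroup.
- exact: lcsS.
- by move=> u v nu _; apply: lcs_comm.
- move=> _ /mapP[[p t] _ ->]; split.
    rewrite -{1}(size_tuple t) -(size_map val); exact: simple_comm_lcs.
  case: t => -[|q s] //= sz; rewrite /comm /=.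
  have [k1 [k1pos a1]] := tors _ (valP p); have [k2 [k2pos a2]] := tors _ (valP q).
  exists (k1 * k2)%N; split; first by rewrite muln_gt0 k1pos.
  have := simple_comm_torsion (s := map val s) a1 a2.
  by move: sz; rewrite eqSS size_map => /eqP->.
apply: (lcs_generated sT (esym genS.2) (generated_subgroup _)) => [u nu|p s pS sS sz].
  by apply: sub_generated; left.
apply: sub_generated; right; apply/mapP => /=.
pose s' : seq S := pmap insub s.
have s'E : map val s' = s.
  rewrite /s' (pmap_filter (insubK _)) -[RHS]filter_predT.
  apply: eq_in_filter => r /sS /=.
  by move=> rS; rewrite insubT.
have sz' : size s' == n.+1 by rewrite -(size_map val) s'E sz.
by exists ([` pS]%fset, Tuple sz'); rewrite ?mem_enum // /comm /= s'E.
Qed.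

(** The quotient of G by [adjoin (gamma 1) x] is finite. Each further term of the series costs only
    finitely many translates, until the term is trivial and the powers of [x] remain. *)
Lemma torsion_virtually_cyclic x : nilpotent_group G ->
  (forall p, p \in S -> exists k, (0 < k)%N /\ adjoin (gamma 1) x (p ^+ k)) ->
  virtually_cyclic G.
Proof.
move=> [c nil] tors; exists x; apply: covered_finite_index.
have nJ n h k : gamma n h -> gamma n (h ^ expgz x k) by move=> nh; apply: lcsJ.
have sub n : is_subgroup (adjoin (gamma n) x).
  by apply: adjoin_subgroup; [exact: lcs_subgroup|exact: nJ].
have step n : covered [set: G] (adjoin (gamma n.+1) x).
  elim: n => [|n IH].
    apply: (@covered_torsion _ _ _ (enum_fset S)) => // [u v _ _|p pS|p _].
    - by apply: sub_adjoin; apply: lcs_comm.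
    - by split=> //; apply: tors.
    - have : generated [set` S] p by rewrite genS.2.
      move: p; apply: generated_min (generated_subgroup _) _ => p pS.
      by apply: sub_generated; right.
  apply: covered_trans IH _; have [F cF] := covered_lcs n tors.
  exists F => _ [h [k [nh ->]]]; have [f Ff nfh] := cF h nh.
  by exists f => //; exists (f^-1 * h), k; rewrite mulgA.
have [F cF] := step c; exists F => g /cF[f Ff [h [k [nh eq]]]]; exists f => //.
rewrite eq; have : gamma c h by apply: lcsS nh.
rewrite -lower_central_series_lcs nil => ->; rewrite mul1g.
apply: (expgz_in _ (generated_subgroup _)).
exact: sub_generated.
Qed.

Import GRing.Theory.

Lemma virtually_cyclic_or_rank2 : nilpotent_group G -> virtually_cyclic G \/
  exists (a b : S) (f1 f2 : G -> rat),
    [/\ {morph f1 : x y / x * y >-> (x + y)%R},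
        {morph f2 : x y / x * y >-> (x + y)%R},
        f1 (val a) = 1%R /\ f1 (val b) = 0%R &
        f2 (val a) = 0%R /\ f2 (val b) = 1%R].
Proof.
move=> nil; have [|ntors] := pselect (exists x, forall p, p \in S ->
    exists k, (0 < k)%N /\ adjoin (gamma 1) x (p ^+ k)).
  by move=> [x tors]; left; apply: torsion_virtually_cyclic nil tors.
right; have hom x : exists (p : S) (f : G -> rat),
    [/\ {morph f : x y / x * y >-> (x + y)%R}, f x = 0%R & f (val p) = 1%R].
  have /existsNP[p /not_implyP[pS none]] : ~ forall p, p \in S ->
      exists k, (0 < k)%N /\ adjoin (gamma 1) x (p ^+ k).
    by move=> tors; apply: ntors; exists x.
  have sH : is_subgroup (adjoin (gamma 1) x).
    by apply: adjoin_subgroup; [exact: lcs_subgroup|move=> h k nh; apply: lcsJ].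
  have [||f [fM f0 f1]] := @exists_additive G (enum_fset S) _ p genS.2 sH.
  - by move=> u v; apply: sub_adjoin; apply: lcs_comm.
  - by move=> n n0 Hn; apply: none; exists n.
  exists [` pS]%fset, f; split=> //; apply: f0; apply: mem_adjoin; exact: lcs_subgroup.
(* The choice x = 1 yields [a] of infinite order in the abelianization; the choice x = a then yields
   [b] independent of [a]. *)
have [a [f1 [f1M _ f1a]]] := hom 1; have [b [f2 [f2M f2a f2b]]] := hom (val a).
(* One elimination step makes the pair dual: [f2] already vanishes at [a]. *)
exists a, b, (fun g => f1 g - f1 (val b) * f2 g)%R, f2; split=> //.
  by move=> u v; rewrite f1M f2M mulrDr opprD addrACA.
by rewrite f1a f2a f2b mulr0 subr0 mulr1 subrr.
Qed.

End Dichotomy.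

(** * Quasigeodesic spirals in groups of rank at least two *)

Section Lipschitz.

Import Order.TTheory GRing.Theory Num.Theory.
Local Open Scope ring_scope.

Variables (G : groupType) (S : {fset G}) (f : G -> rat).
Hypothesis genS : generating_set S.
Hypothesis fM : {morph f : x y / (x * y)%g >-> x + y}.

Lemma additive_lipschitz :
  exists C : nat, forall g, `|f g| <= (C * word_length S g)%:R.
Proof.
pose C := (\sum_(s : S) Num.bound `|f (val s)|)%N.
have f1 : f 1%g = 0 by apply: (additive1 (@subgroup_setT G)) => x y _ _.
have bound (s : S) : `|f (val s)| <= C%:R.
  apply: (le_trans (ltW (archi_boundP (normr_ge0 _)))).
  by rewrite ler_nat /C (bigD1 s) //= leq_addr.
exists C => g; have [w [<- <-]] := geodesic_word genS g.
elim: w => [|s w IH]; first by rewrite eval_nil f1 normr0.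
rewrite eval_cons fM; apply: (le_trans (ler_normD _ _)).
by rewrite /= mulnS natrD lerD ?bound.
Qed.

End Lipschitz.

Section Spiral.

Import Order.TTheory GRing.Theory Num.Theory.

Variables (G : groupType) (S : {fset G}).
Hypothesis genS : generating_set S.
Variables (a b : S) (f1 f2 : G -> rat).
Hypothesis f1M : {morph f1 : x y / x * y >-> (x + y)%R}.
Hypothesis f2M : {morph f2 : x y / x * y >-> (x + y)%R}.
Hypothesis f1a : f1 (val a) = 1%R.
Hypothesis f1b : f1 (val b) = 0%R.
Hypothesis f2a : f2 (val a) = 0%R.
Hypothesis f2b : f2 (val b) = 1%R.

Local Notation len := (word_length S).

Let a' : S := [` genS.1 _ (valP a)]%fset.
Let b' : S := [` genS.1 _ (valP b)]%fset.
Let letters : seq S := [:: a; b; a'; b'].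

Let sT := @subgroup_setT G.
Let f1T : additive_on [set: G] f1. Proof. by move=> x y _ _; apply: f1M. Qed.
Let f2T : additive_on [set: G] f2. Proof. by move=> x y _ _; apply: f2M. Qed.
Let f1V x : f1 x^-1 = (- f1 x)%R. Proof. exact: (additiveV sT f1T). Qed.
Let f2V x : f2 x^-1 = (- f2 x)%R. Proof. exact: (additiveV sT f2T). Qed.
Let f1X x n : f1 (x ^+ n) = (f1 x *+ n)%R. Proof. exact: (additiveX n sT f1T). Qed.
Let f2X x n : f2 (x ^+ n) = (f2 x *+ n)%R. Proof. exact: (additiveX n sT f2T). Qed.

Lemma uniq_letters : uniq letters.
Proof.
have f1a' : f1 (val a') = (-1)%R by rewrite f1V f1a.
have f1b' : f1 (val b') = 0%R by rewrite f1V f1b GRing.oppr0.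
have f2b' : f2 (val b') = (-1)%R by rewrite f2V f2b.
rewrite /= !inE !negb_or -!andbA !andbT.
apply/and5P; split; last (apply/andP; split); apply/eqP => eq.
- by move: f1a; rewrite eq f1b.
- by move: f1a; rewrite eq f1a'.
- by move: f1a; rewrite eq f1b'.
- by move: f1b; rewrite eq f1a'.
- by move: f2b; rewrite eq f2b'.
- by move: f1a'; rewrite eq f1b'.
Qed.

Definition spiral (i j k l : nat) : seq S :=
  nseq i a ++ nseq j b ++ nseq k a' ++ nseq l b'.

(** Spirals are the words in [letters] that are sorted for this preorder. Sortedness passes to
    infixes and survives the pumping of constant blocks, so block boundaries need not be tracked. *)
Let before (s t : S) := index s letters <= index t letters.

Lemma before_anti s t : s \in letters -> before s t -> before t s -> s = t.
Proof.
move=> sl st ts; have eq : index s letters = index t letters.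
  by apply/eqP; rewrite eqn_leq; apply/andP.
by rewrite -(nth_index s sl) eq nth_index // -index_mem -eq index_mem.
Qed.

Lemma count_spiral x i j k l : count_mem x (spiral i j k l) =
  ((a == x) * i + (b == x) * j + (a' == x) * k + (b' == x) * l)%N.
Proof. by rewrite !count_cat !count_nseq /= !addnA. Qed.

Lemma size_spiral i j k l : size (spiral i j k l) = (i + j + k + l)%N.
Proof. by rewrite !size_cat !size_nseq !addnA. Qed.

Lemma spiral_letters i j k l : {subset spiral i j k l <= letters}.
Proof.
move=> x; rewrite !mem_cat !mem_nseq !inE.
by case/or4P=> /andP[_ ->]; rewrite ?orbT.
Qed.

Lemma before_nth m n : m < 4 -> n < 4 ->
  before (nth a letters m) (nth a letters n) = (m <= n).
Proof. by move=> m4 n4; rewrite /before !index_uniq ?uniq_letters. Qed.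

Lemma pairwise_spiral i j k l : pairwise before (spiral i j k l).
Proof.
have pn x n : pairwise before (nseq n x).
  elim: n => //= n ->; rewrite andbT; apply/allP => y.
  by rewrite mem_nseq => /andP[_ /eqP->]; apply: leqnn.
have ar m n p q : m <= n -> n < 4 ->
    allrel before (nseq p (nth a letters m)) (nseq q (nth a letters n)).
  move=> mn n4; apply/allrelP => x y; rewrite !mem_nseq.
  by move=> /andP[_ /eqP->] /andP[_ /eqP->]; rewrite before_nth ?(leq_ltn_trans mn n4).
rewrite !pairwise_cat !pn !allrel_catr !andbT.
by rewrite (ar 0 1)%N // (ar 0 2)%N // (ar 0 3)%N //
  (ar 1 2)%N // (ar 1 3)%N // (ar 2 3)%N.
Qed.

Lemma spiral_shape w : pairwise before w -> {subset w <= letters} ->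
  w = spiral (count_mem a w) (count_mem b w) (count_mem a' w) (count_mem b' w).
Proof.
move=> pw wl; have tr : transitive before by move=> y x z; apply: leq_trans.
apply: (sorted_eq_in (leT := before)).
- by move=> x y z _ _ _; apply: tr.
- by move=> x y /wl xl _ /andP[xy yx]; apply: before_anti.
- by rewrite sorted_pairwise.
- by rewrite sorted_pairwise //; apply: pairwise_spiral.
apply/allP => x; rewrite mem_cat => xw; apply/eqP.
have {xw} xl : x \in letters by case/orP: xw => [/wl //|/spiral_letters].
rewrite count_spiral.
have := uniq_letters; rewrite /= !inE !negb_or -!andbA !andbT.
move: xl; rewrite !inE => /or4P[] /eqP-> /and5P[n1 n2 n3 n4 /andP[n5 n6]].
all: rewrite ?(eq_sym b a) ?(eq_sym a' a) ?(eq_sym b' a) ?(eq_sym a' b)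
       ?(eq_sym b' b) ?(eq_sym b' a') ?eqxx ?(negbTE n1) ?(negbTE n2)
       ?(negbTE n3) ?(negbTE n4) ?(negbTE n5) ?(negbTE n6).
all: by rewrite ?mul0n ?mul1n ?addn0 ?add0n.
Qed.

Lemma count_spiral_letters i j k l :
  [/\ count_mem a (spiral i j k l) = i, count_mem b (spiral i j k l) = j,
      count_mem a' (spiral i j k l) = k & count_mem b' (spiral i j k l) = l].
Proof.
have := uniq_letters; rewrite /= !inE !negb_or -!andbA !andbT !count_spiral.
move=> /and5P[n1 n2 n3 n4 /andP[n5 n6]].
by rewrite ?(eq_sym b a) ?(eq_sym a' a) ?(eq_sym b' a) ?(eq_sym a' b)
  ?(eq_sym b' b) ?(eq_sym b' a') ?eqxx ?(negbTE n1) ?(negbTE n2)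
  ?(negbTE n3) ?(negbTE n4) ?(negbTE n5) ?(negbTE n6) ?mul0n ?mul1n ?addn0 ?add0n.
Qed.

Lemma eval_spiral i j k l : eval_word (spiral i j k l) =
  val a ^+ i * val b ^+ j * val a ^- k * val b ^- l.
Proof. by rewrite /spiral !eval_cat !eval_nseq !expVgn !mulgA. Qed.

Lemma f1_spiral i j k l : f1 (eval_word (spiral i j k l)) = (i%:R - k%:R)%R.
Proof.
by rewrite eval_spiral !f1M !f1V !f1X f1a f1b !GRing.mul0rn GRing.oppr0 !GRing.addr0.
Qed.

Lemma f2_spiral i j k l : f2 (eval_word (spiral i j k l)) = (j%:R - l%:R)%R.
Proof.
rewrite eval_spiral !f2M !f2V !f2X f2a f2b.
by rewrite !GRing.mul0rn GRing.oppr0 GRing.add0r GRing.subr0.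
Qed.

(** If [u] contains both [a] and [a'], sortedness excludes a [b] before [u] and a [b] after [u], so
    [u] contains the whole block of [b]. The same holds for [a'] between [b] and [b']. *)
Lemma spiral_infix i j k l u : infix u (spiral i j k l) ->
  exists i1 j1 k1 l1, [/\ u = spiral i1 j1 k1 l1,
    [/\ i1 <= i, j1 <= j, k1 <= k & l1 <= l],
    0 < i1 -> 0 < k1 -> j1 = j & 0 < j1 -> 0 < l1 -> k1 = k].
Proof.
move=> /infixP[p [s eq]]; have := pairwise_spiral i j k l.
have := @spiral_letters i j k l; rewrite eq => lt.
rewrite !pairwise_cat !allrel_catr => /and3P[/andP[pu ps] pp /and3P[us uu ss]].
have ul : {subset u <= letters} by move=> x xu; apply: lt; rewrite !mem_cat xu orbT.
have cnt x : (count_mem x p + (count_mem x u + count_mem x s))%N =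
    count_mem x (spiral i j k l) by rewrite eq !count_cat.
have sep m n (x y : seq S) : m < 4 -> n < 4 -> n < m -> allrel before x y ->
    0 < count_mem (nth a letters n) y -> count_mem (nth a letters m) x = 0.
  move=> m4 n4 nm /allrelP xy; rewrite -has_count has_pred1 => yn.
  apply/count_memPn/negP => xm; have := xy _ _ xm yn.
  by rewrite before_nth // leqNgt nm.
have [ca cb ca' cb'] := count_spiral_letters i j k l.
exists (count_mem a u), (count_mem b u), (count_mem a' u), (count_mem b' u).
split; first exact: spiral_shape.
- have le x : count_mem x u <= count_mem x (spiral i j k l).
    by rewrite -cnt addnCA leq_addr.
  by have := le a; have := le b; have := le a'; have := le b'; rewrite ca cb ca' cb'.
- move=> au a'u; have /= pb := sep 1%N 0%N p u isT isT isT pu au.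
  have sb : count_mem b s = 0%N.
    case: (posnP (count_mem b s)) => // bs.
    have /= a'0 := sep 2%N 1%N u s isT isT isT us bs.
    by rewrite a'0 in a'u.
  by rewrite -cb -cnt pb sb addn0.
- move=> bu b'u; have /= pa' := sep 2%N 1%N p u isT isT isT pu bu.
  have sa' : count_mem a' s = 0%N.
    case: (posnP (count_mem a' s)) => // a's.
    have /= b'0 := sep 3%N 2%N u s isT isT isT us a's.
    by rewrite b'0 in b'u.
  by rewrite -ca' -cnt pa' sa' addn0.
Qed.

Variable K : nat.

Definition stretch_le (w : seq S) : Prop :=
  forall u, infix u w -> size u <= K * len (eval_word u).

(** With D = C len(g), the homomorphisms bound |i1 - k1| and |j1 - l1| by D. If all four blocks
    occur, then k1 = k >= 2 i1 gives k <= 2 D and i1 <= D, hence j1 <= 2 D and l1 <= 3 D, in all 8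
    D. The other cases give less. *)
Lemma spiral_stretch C i j k l :
  (forall g, (`|f1 g| <= (C * len g)%:R /\ `|f2 g| <= (C * len g)%:R)%R) ->
  K = (9 * C)%N -> 0 < i -> i <= j -> j <= k -> (2 * i <= k)%N ->
  stretch_le (spiral i j k l).
Proof.
move=> lip KE i0 ij jk ik u /spiral_infix[i1 [j1 [k1 [l1 [-> [ii jj kk ll] jE kE]]]]].
rewrite size_spiral KE -mulnA; set g := eval_word _; have [lip1 lip2] := lip g.
have dist (m n : nat) : (`|m%:R - n%:R| = (m - n + (n - m))%N%:R :> rat)%R.
  case: (leqP n m) => [le|/ltnW le].
    by rewrite (eqP le) addn0 natrB // ger0_norm // subr_ge0 ler_nat.
  by rewrite (eqP le) add0n natrB // distrC ger0_norm // subr_ge0 ler_nat.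
move: lip1 lip2; rewrite f1_spiral f2_spiral !dist !ler_nat.
move: (C * len g)%N => D d1 d2.
case: (posnP i1) => [?|/jE {}jE]; case: (posnP k1) => [?|/jE {}jE];
case: (posnP j1) => [?|/kE {}kE]; case: (posnP l1) => [?|/kE {}kE]; lia.
Qed.

Lemma infix_spiral_ab i j k l n :
  n <= i -> n <= k -> infix (spiral n j n 0) (spiral i j k l).
Proof.
move=> /subnK <- /subnKC <-; apply/infixP.
exists (nseq (i - n) a), (nseq (k - n) a' ++ nseq l b').
by rewrite /spiral !nseqD cats0 -!catA.
Qed.

Lemma infix_spiral_ba i j k l : l <= j -> infix (spiral 0 l k l) (spiral i j k l).
Proof.
move=> /subnK <-; apply/infixP; exists (nseq i a ++ nseq (j - l) b), [::].
by rewrite /spiral nseqD cats0 -!catA.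
Qed.

(** A nonempty loop of the automaton that remembers the last letter ends with the letter that
    precedes it; in a sorted word all letters in between agree with it. *)
Lemma loop_constant (u v : seq S) : pairwise before (u ++ v) ->
  {subset v <= letters} ->
  foldl (fun=> Some) None (u ++ v) = foldl (fun=> Some) (@None S) u ->
  exists e, forall s, s \in v -> s = e.
Proof.
have foldS q (x : seq S) s : foldl (fun=> Some) q (rcons x s) = Some s.
  by rewrite -cats1 foldl_cat.
case/lastP: v => [|v e]; first by exists a.
rewrite -rcons_cat foldS; case/lastP: u => [//|u e']; rewrite foldS => pw vl [ee'].
exists e => s; rewrite mem_rcons inE => /orP[/eqP//|sv].
apply: before_anti; first by apply: vl; rewrite mem_rcons inE sv orbT.
  move: pw; rewrite pairwise_rcons all_cat => /andP[/andP[_ /allP]].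
  by move=> /(_ _ sv).
move: pw; rewrite rcons_cat pairwise_cat => /andP[/allrelP ar _].
by apply: ar; rewrite mem_rcons inE ?ee' ?eqxx // sv orbT.
Qed.

Lemma mem_pow_word t (v : seq S) x : x \in pow_word t v -> x \in v.
Proof. by move=> /flattenP[y]; rewrite mem_nseq => /andP[_ /eqP->]. Qed.

Lemma count_pow_word t (v : seq S) x :
  count_mem x (pow_word t v) = (t * count_mem x v)%N.
Proof. by elim: t => // t IH; rewrite /pow_word /= count_cat IH. Qed.

Lemma pairwise_pow_word t (v : seq S) e : (forall s, s \in v -> s = e) ->
  pairwise before (pow_word t v).
Proof.
move=> ve; have : forall s, s \in pow_word t v -> s = e by move=> s /mem_pow_word/ve.
elim: (pow_word t v) => //= x w IH H; apply/andP; split.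
  apply/allP => y yw; rewrite (H y) ?inE ?yw ?orbT // (H x) ?mem_head //.
  exact: leqnn.
by apply: IH => s sw; apply: H; rewrite inE sw orbT.
Qed.

Lemma stretch_not_context_free C : nilpotent_group G ->
  (forall g, (`|f1 g| <= (C * len g)%:R /\ `|f2 g| <= (C * len g)%:R)%R) ->
  K = (9 * C)%N -> ~ context_free [set w | stretch_le w].
Proof.
move=> nilG lip KE cf.
have [N ogd] := ogden (pred1 a) (fun=> Some) (@None S) cf.
(* Each exponent depends on the earlier ones: [k] makes a^k b^i a^-k short, and [l] makes b^l a^-k
   b^-l short. *)
pose i := N.+1.
have [k [ik kbad]] := conj_sublinear (val a) genS nilG (val b ^+ i) K (2 * i)%N.
have [l [l0 lbad]] := conj_sublinear (val b) genS nilG (val a ^- k) K 1%N.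
have bad1 w : stretch_le w -> ~~ infix (spiral k i k 0) w.
  move=> sw; apply/negP => /sw; rewrite size_spiral eval_spiral expg0 invg1 mulg1 /i.
  by move=> h; have := leq_trans h kbad; lia.
have bad2 w : stretch_le w -> ~~ infix (spiral 0 l k l) w.
  move=> sw; apply/negP => /sw; rewrite size_spiral eval_spiral expg0 mul1g.
  by move=> h; have := leq_trans h lbad; lia.
have good : stretch_le (spiral i i k l).
  by apply: (spiral_stretch lip KE) => //; rewrite /i in ik *; lia.
have [ca cb ca' cb'] := count_spiral_letters i i k l.
have [|u [v [y [v' [z [wE lv lv' pos pump]]]]]] := ogd _ good; first by rewrite ca.
have := pairwise_spiral i i k l; have := @spiral_letters i i k l.
have cnt x : (count_mem x u + (count_mem x v + (count_mem x y +
    (count_mem x v' + count_mem x z))))%N = count_mem x (spiral i i k l).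
  by rewrite wE !count_cat.
rewrite wE => wl pw.
have pre x x' : pairwise before (x ++ x') -> pairwise before x.
  by rewrite pairwise_cat => /and3P[].
have [e ve] : exists e, forall s, s \in v -> s = e.
  apply: (@loop_constant u v) => //.
    by apply: (pre _ (y ++ v' ++ z)); rewrite -catA.
  by move=> s sv; apply: wl; rewrite !mem_cat sv orbT.
have [e' ve'] : exists e', forall s, s \in v' -> s = e'.
  apply: (@loop_constant (u ++ v ++ y) v') => //; last by rewrite -!catA.
    by apply: (pre _ z); rewrite -!catA.
  by move=> s sv; apply: wl; rewrite !mem_cat sv !orbT.
pose m x := (count_mem x v + count_mem x v')%N.
(* Enough repetitions to lift any pumped exponent above both [k] and [l]. *)
pose t := (k + l)%N; set w := u ++ pow_word t.+1 v ++ y ++ pow_word t.+1 v' ++ z.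
have sw : stretch_le w by apply: pump.
have wl' vt vt' : {subset vt <= v} -> {subset vt' <= v'} ->
    {subset u ++ vt ++ y ++ vt' ++ z <= letters}.
  move=> vtv vtv' x; rewrite !mem_cat => /or4P[xu|/vtv xv|xy|/orP[/vtv' xv'|xz]];
  by apply: wl; rewrite !mem_cat ?xu ?xv ?xy ?xv' ?xz ?orbT.
have pw' vt vt' : {subset vt <= v} -> {subset vt' <= v'} ->
    pairwise before vt -> pairwise before vt' ->
    pairwise before (u ++ vt ++ y ++ vt' ++ z).
  move=> vtv vtv' pvt pvt'; move: pw; rewrite !pairwise_cat !allrel_catr pvt pvt'.
  move=> /and3P[/and4P[uv uy uv' uz] -> /and3P[/and3P[vy vv' vz] _]].
  move=> /and3P[/andP[yv' ->] -> /and3P[v'z _ ->]]; rewrite uy uz.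
  rewrite !andbT; have subr x x1 x2 : {subset x1 <= x2} ->
      allrel before x x2 -> allrel before x x1.
    by move=> x12 /allrelP ar; apply/allrelP => r r' rx /x12; apply: ar.
  have subl x x1 x2 : {subset x1 <= x2} ->
      allrel before x2 x -> allrel before x1 x.
    by move=> x12 /allrelP ar; apply/allrelP => r r' /x12; apply: ar.
  rewrite (subr _ _ _ vtv uv) (subr _ _ _ vtv' uv') (subl _ _ _ vtv vy).
  by rewrite (subl _ _ _ vtv (subr _ _ _ vtv' vv')) (subl _ _ _ vtv vz)
    (subr _ _ _ vtv' yv') (subl _ _ _ vtv' v'z).
have wl2 : {subset w <= letters} by apply: wl' => x /mem_pow_word.
have pw2 : pairwise before w.
  apply: pw' => [x /mem_pow_word //|x /mem_pow_word //||].
    exact: pairwise_pow_word ve.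
  exact: pairwise_pow_word ve'.
have cw x : count_mem x w = (count_mem x (spiral i i k l) + t * m x)%N.
  have cntw vt vt' : count_mem x (u ++ vt ++ y ++ vt' ++ z) =
    (count_mem x u + (count_mem x vt + (count_mem x y + (count_mem x vt' +
      count_mem x z))))%N by rewrite !count_cat.
  by rewrite cntw -cnt !count_pow_word /m; lia.
have only x : 0 < m x -> x = e \/ x = e'.
  rewrite addn_gt0 -!has_count !has_pred1 => /orP[/ve|/ve']; by [left|right].
have ma : 0 < m a by move: pos; rewrite count_cat.
have := spiral_shape pw2 wl2; rewrite !cw ca cb ca' cb' => wshape.
(* If [b] is not pumped, a^k b^i a^-k occurs. Otherwise [a] and [b] use up both pumped letters, the
   exponents [k] and [l] stay, and that of [b] exceeds [l]. *)
have [mb|mb] := posnP (m b).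
  have := bad1 _ sw; rewrite wshape mb muln0 addn0; case/negP.
  by apply: infix_spiral_ab; rewrite /t; nia.
have [ma'0 mb'0] : m a' = 0%N /\ m b' = 0%N.
  have := uniq_letters; rewrite /= !inE !negb_or -!andbA !andbT.
  move=> /and5P[/eqP n1 /eqP n2 /eqP n3 /eqP n4 /andP[/eqP n5 _]].
  have excl x : a <> x -> b <> x -> m x = 0%N.
    move=> ax bx; case: (posnP (m x)) => // /only; have := only _ ma; have := only _ mb.
    by move=> [] h1 [] h2 [] h3; congruence.
  by split; apply: excl.
have := bad2 _ sw; rewrite wshape ma'0 mb'0 !muln0 !addn0; case/negP.
by apply: infix_spiral_ba; rewrite /t; nia.
Qed.

End Spiral.

(** * Quasigeodesics in groups quasi-isometric to a line *)

Lemma cat_split (T : Type) (x u w v : seq T) : x ++ u = w ++ v ->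
  (exists w', w = x ++ w' /\ u = w' ++ v) \/ (exists x', v = x' ++ u).
Proof.
elim: x w => [|t x IH] [|t' w] /=.
- by move=> ->; left; exists [::].
- by move=> ->; left; exists (t' :: w).
- by move=> <-; right; exists (t :: x).
- by move=> [-> /IH[[w' [-> ->]]|[x' ->]]]; [left; exists w'|right; exists x'].
Qed.

Lemma infix_rconsP (T : eqType) (u w : seq T) t : infix u (rcons w t) ->
  infix u w \/ exists x, rcons w t = x ++ u.
Proof.
move=> /infixP[x [y]]; case/lastP: y => [|y r]; first by rewrite cats0; right; exists x.
by rewrite -!rcons_cat => /rcons_inj[-> _]; left; apply/infixP; exists x, y.
Qed.

Section Quasiline.

Variables (G : groupType) (S : {fset G}).
Hypothesis genS : generating_set S.

Local Notation len := (word_length S).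

Variables (pi : G -> int) (L A B : nat).
Hypothesis pi_step : forall g (s : S), `|pi (g * val s)%g - pi g|%N <= L.
Hypothesis len_pi : forall g h, len (g^-1 * h) <= A * `|pi g - pi h|%N + B.

(** A discrete intermediate value theorem for [pi] along a path. *)
Lemma path_meets_level (w : seq S) g (h : int) :
  (pi g <= h <= pi (g * eval_word w)%g)%R || (pi (g * eval_word w)%g <= h <= pi g)%R ->
  exists w1 w2, w = w1 ++ w2 /\ `|pi (g * eval_word w1)%g - h|%N <= L.
Proof.
elim: w g => [|s w IH] g.
  rewrite eval_nil mulg1 => le; exists [::], [::].
  by rewrite eval_nil mulg1; split=> //; lia.
rewrite eval_cons mulgA => le; have st := pi_step g s.
have [lt|le'] := boolP ((pi (g * val s)%g <= h <= pi (g * val s * eval_word w)%g)%R ||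
    (pi (g * val s * eval_word w)%g <= h <= pi (g * val s)%g)%R).
  have [w1 [w2 [-> d]]] := IH _ lt; exists (s :: w1), w2; split=> //.
  by rewrite eval_cons mulgA.
exists [::], (s :: w); rewrite eval_nil mulg1; split=> //.
move: (pi g) (pi (g * val s)) (pi (g * val s * eval_word w)) le st le' => x y z; lia.
Qed.

Definition stretch (p q K : nat) (w : seq S) : Prop :=
  forall u, infix u w -> q * size u <= p * len (eval_word u) + K.

Lemma stretch_infix p q K u w : infix u w -> stretch p q K w -> stretch p q K u.
Proof. by move=> uw sw x xu; apply: sw; apply: infix_trans uw. Qed.

(* A geodesic joining the endpoints of a quasigeodesic passes close to every
   point of it: of the three levels [pi 1], [pi u], [pi (u v)] one is the median. *)
Lemma geodesic_gate p q K (u v : seq S) : 0 < q -> stretch p q K (u ++ v) ->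
  exists b, len b <= A * L + B + (p * (A * L + B) + K) /\
    len (eval_word (u ++ v)) = (len (eval_word u * b) + len (b^-1 * eval_word v))%N.
Proof.
move=> q0 suv; set R := (A * L + B)%N; set gu := eval_word u; set gv := eval_word v.
rewrite eval_cat -/gu -/gv.
have near g h l : `|pi g - pi h|%N <= l -> len (g^-1 * h) <= A * l + B.
  by move=> le; apply: leq_trans (len_pi g h) _; rewrite leq_add2r leq_mul2l le orbT.
have short (x : seq S) : infix x (u ++ v) ->
    len (eval_word x) <= R -> size x <= p * R + K.
  move=> /suv le lx; apply: leq_trans (leq_pmull _ q0) _; apply: leq_trans le _.
  by rewrite leq_add2r leq_mul2l lx orbT.
have [m1|nm1] := boolP ((pi 1%g <= pi gu <= pi (gu * gv)%g)%R ||
    (pi (gu * gv)%g <= pi gu <= pi 1%g)%R).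
  have [y [sy ey]] := geodesic_word genS (gu * gv).
  have [|y1 [y2 [yE d]]] := @path_meets_level y 1 (pi gu); first by rewrite ey mul1g.
  rewrite mul1g in d; set x := eval_word y1 in d.
  exists (gu^-1 * x); split.
    by apply: leq_trans (near gu x L _) _; [rewrite distnC|rewrite leq_addr].
  rewrite mulVKg invgM invgK -mulgA; apply/eqP; rewrite eqn_leq; apply/andP; split.
    by have := lenM genS x (x^-1 * (gu * gv)); rewrite mulVKg.
  have -> : x^-1 * (gu * gv) = eval_word y2.
    by rewrite -ey yE eval_cat mulKg.
  by rewrite -sy yE size_cat leq_add // len_eval.
have [m2|nm2] := boolP ((pi 1%g <= pi (gu * gv)%g <= pi gu)%R ||
    (pi gu <= pi (gu * gv)%g <= pi 1%g)%R).
  (* The path [u] has already crossed the level of the endpoint. The rest of the word has nearby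
     ends and, being quasigeodesic, is short; the endpoint itself serves as the gate. *)
  have [|u1 [u2 [uE d]]] := @path_meets_level u 1 (pi (gu * gv)); first by rewrite mul1g.
  exists gv; rewrite mulVg len1 // addn0; split=> //.
  apply: leq_trans (leq_addl _ _); apply: leq_trans (len_eval genS v) _.
  apply: leq_trans (short (u2 ++ v) _ _); first by rewrite size_cat leq_addl.
    by apply/infixP; exists u1, [::]; rewrite cats0 catA uE.
  have -> : eval_word (u2 ++ v) = (eval_word u1)^-1 * (gu * gv).
    by rewrite /gu uE !eval_cat -!mulgA mulKg.
  by apply: near; rewrite mul1g in d.
(* The symmetric case: [v] returns to the level of the origin, so [u] is short and the origin serves
   as the gate. *)
have [|v1 [v2 [vE d]]] := @path_meets_level v gu (pi 1).
  by move: (pi 1) (pi gu) (pi (gu * gv)) nm1 nm2 => x y z; lia.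
exists gu^-1; rewrite mulgV len1 // add0n invgK; split=> //.
rewrite lenV //; apply: leq_trans (leq_addl _ _); apply: leq_trans (len_eval genS u) _.
apply: leq_trans (short (u ++ v1) _ _); first by rewrite size_cat leq_addr.
  by apply/infixP; exists [::], v2; rewrite vE catA.
rewrite -[eval_word _]mul1g -invg1 eval_cat; apply: near; by rewrite distnC.
Qed.

(** * Finitely many states from truncated defects *)

Section Automaton.

Variables (p q K : nat).
Hypothesis q0 : 0 < q.

(* Appending one letter to a [(p, q, K)]-stretch word keeps it [(p, q, K')]-stretch. *)
Let K' := (K + p + q)%N.
Let radius := (A * L + B + (p * (A * L + B) + K'))%N.
(** A finite type that covers the ball of this radius: words padded with [None], possibly several
    for one element. *)
Let ball := (radius.-tuple (option S))%type.
Let ball_val (t : ball) : G := eval_word (pmap id t).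
(** For a stretch word the defects at [b] in the ball are at most [p * radius + K]; cut off below at
    minus [p * radius] and shifted by that amount, they lie below [bound]. *)
Let bound := (2 * p * radius + K).+1.

Let ballP b : len b <= radius -> exists t, ball_val t = b.
Proof.
have [w [<- <-]] := geodesic_word genS b => sz.
have szt : size (map Some w ++ nseq (radius - size w) None) == radius.
  by rewrite size_cat size_map size_nseq subnKC.
exists (Tuple szt); rewrite /ball_val /= pmap_cat.
have -> n : pmap id (nseq n (@None S)) = [::] by elim: n.
by rewrite cats0 map_pK.
Qed.

Let defect_ge (w : seq S) (b : G) (r : nat) : Prop := exists x u,
  w = x ++ u /\ r + p * len (eval_word u * b) <= q * size u + p * radius.

(* The truncated function sending [b] in a ball to the maximum of
   [q |u| - p len (u b)] over the suffixes [u] of the word read so far. *)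
Let state (w : seq S) : option {ffun ball * 'I_bound -> bool} :=
  if `[< stretch p q K w >]
  then Some [ffun x : ball * 'I_bound => `[< defect_ge w (ball_val x.1) x.2 >]] else None.

Let defect_transfer w1 w2 x2 u2 b : state w1 = state w2 -> stretch p q K w1 ->
  stretch p q K w2 -> w2 = x2 ++ u2 -> len b <= radius ->
  exists x1 u1, w1 = x1 ++ u1 /\
    q * size u2 + p * len (eval_word u1 * b) <= q * size u1 + p * len (eval_word u2 * b).
Proof.
move=> st12 s1 s2 w2E lb; have [t tb] := ballP lb.
case: (leqP (q * size u2 + p * radius) (p * len (eval_word u2 * b))) => [le|lt].
  (* A defect below the cut-off is matched by the empty suffix, whose defect at [b] is at least
     minus [p * radius]. *)
  exists w1, [::]; rewrite cats0 eval_nil mul1g muln0 add0n; split=> //.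
  by apply: leq_trans le; rewrite leq_add2l leq_mul2l lb orbT.
pose r := (q * size u2 + p * radius - p * len (eval_word u2 * b))%N.
have rb : r < bound.
  rewrite ltnS leq_subLR; have := s2 u2.
  rewrite w2E suffix_infix ?suffix_suffix // => /(_ isT) le.
  have := lenM genS (eval_word u2 * b) b^-1; rewrite mulgK lenV // => tri.
  have : p * len (eval_word u2) <= p * (len (eval_word u2 * b) + radius).
    by rewrite leq_mul2l (leq_trans tri) ?orbT // leq_add2l.
  rewrite -mulnA; move: le; rewrite mulnDr.
  move: (p * len (eval_word u2))%N (p * len (eval_word u2 * b))%N => y z.
  move: (p * radius)%N => t0.
  by move: (q * _)%N => n; lia.
have /asboolP d2 : `[< defect_ge w2 (ball_val (t, Ordinal rb).1) (t, Ordinal rb).2 >].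
  by apply/asboolP; exists x2, u2; split=> //; rewrite /= tb /r subnK // ltnW.
move: st12; rewrite /state (asboolT s1) (asboolT s2) => -[/ffunP/(_ (t, Ordinal rb))].
rewrite !ffunE (asboolT d2) => /asboolP[x1 [u1 [w1E]]].
rewrite /= tb /r => le; exists x1, u1; split=> //.
move: le; move: (p * len _)%N (p * len _)%N lt => y z; lia.
Qed.

(** Letter by letter, only suffixes u2 v s that reach into [w2] are new. Their geodesic passes the
    gate u2 b, so their length splits there. Equal states give a suffix u1 of [w1] with at least the
    same defect at [b], and the inequality for u1 v s implies the one for u2 v s. *)
Lemma state_nerode w1 w2 v : state w1 = state w2 ->
  stretch p q K (w1 ++ v) -> stretch p q K (w2 ++ v).
Proof.
move=> st12; elim/last_ind: v => [|v s IH].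
  rewrite !cats0 => s1; move: st12; rewrite /state (asboolT s1).
  by case: asboolP.
rewrite -!rcons_cat => s1.
have s1' : stretch p q K (w1 ++ v).
  by apply: stretch_infix s1; rewrite -cats1 prefix_infix // prefix_prefix.
have s2 := IH s1'; have infl (x y : seq S) : infix x (x ++ y).
  by rewrite prefix_infix // prefix_prefix.
have infr (x y : seq S) : infix y (x ++ y) by rewrite suffix_infix // suffix_suffix.
move=> u /infix_rconsP[/s2 //|[x]]; rewrite rcons_cat => /esym/cat_split.
case=> [[u2 [w2E ->]]|[x' vE]]; last first.
  by apply: s1; rewrite rcons_cat vE catA infr.
have su2 : stretch p q K (u2 ++ v).
  by apply: stretch_infix s2; rewrite w2E -catA infr.
have su2s : stretch p q K' (u2 ++ rcons v s).
  move=> y; rewrite -rcons_cat => /infix_rconsP[/su2 le|[z eq]].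
    by apply: leq_trans le _; rewrite leq_add2l /K' -addnA leq_addr.
  case/lastP: y eq => [|y s']; first by rewrite muln0.
  rewrite -rcons_cat => /rcons_inj[eq <-].
  have := su2 y; rewrite eq infr => /(_ isT) le.
  have := lenM genS (eval_word (rcons y s)) (val s)^-1.
  rewrite -cats1 eval_cat eval_cons eval_nil mulg1 mulgK lenV //.
  have := len_eval genS [:: s]; rewrite eval_cons eval_nil mulg1 size_cat /=.
  move: le; rewrite /K'; move: (len _) (len _) (len _) => l1 l2 l3 h1 h2 h3.
  have := leq_mul (leqnn p) (leq_trans h3 (leq_add (leqnn _) h2)).
  rewrite !mulnDr !muln1 => le2.
  by move: (q * _)%N (p * _)%N (p * _)%N h1 le2; clear; lia.
have [b [lb gate]] := geodesic_gate q0 su2s.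
have s1w : stretch p q K w1 by apply: stretch_infix s1'; apply: infl.
have s2w : stretch p q K w2 by apply: stretch_infix s2; apply: infl.
have [x1 [u1 [w1E le]]] := defect_transfer st12 s1w s2w w2E lb.
have := s1 (u1 ++ rcons v s); rewrite rcons_cat w1E -catA infr => /(_ isT).
rewrite gate eval_cat => le1.
have := lenM genS (eval_word u1 * b) (b^-1 * eval_word (rcons v s)).
rewrite mulgA mulgK => tri; rewrite !size_cat in le1 *.
have {}tri := leq_mul (leqnn p) tri; rewrite !mulnDr in le1 tri *.
move: (p * len (eval_word u1 * b))%N (p * len (eval_word u2 * b))%N le tri => y z.
move: (p * len (b^-1 * _))%N (p * len _)%N le1 => l1 l2.
move: (q * _)%N (q * _)%N (q * _)%N; clear; lia.
Qed.

Lemma stretch_context_free : context_free [set w | stretch p q K w].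
Proof. exact: finite_nerode_context_free state_nerode. Qed.

End Automaton.

End Quasiline.

(** * A coarse coordinate on a virtually cyclic group *)

Section VirtuallyCyclic.

Variables (G : groupType) (S : {fset G}).
Hypothesis genS : generating_set S.

Local Notation len := (word_length S).

Lemma finite_index_covered (H : set G) : is_subgroup H -> finite_index H ->
  covered [set: G] H.
Proof.
move=> sH /finite_seqP[s sE]; exists [seq xget 1 C | C <- s] => g _.
pose C := [set (g * h)%g | h in H].
have Cg : C g by exists 1; [exact: subgroup1|rewrite mulg1].
exists (xget 1 C).
  by apply: map_f; have : [set` s] C by rewrite -sE; exists g.
have [h Hh <-] := xgetPex 1 (ex_intro C g Cg).
by rewrite invgM mulgVK; apply: subgroupV.
Qed.

Lemma len_expgz (x : G) (k : int) : len (expgz x k) <= `|k|%N * len x.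
Proof.
by case: k => n /=; rewrite ?lenV //; apply: lenX.
Qed.

Lemma virtually_cyclic_quasiline : virtually_cyclic G ->
  exists (pi : G -> int) (L A B : nat),
    (forall g (s : S), `|pi (g * val s)%g - pi g|%N <= L) /\
    (forall g h, len (g^-1 * h) <= A * `|pi g - pi h|%N + B).
Proof.
move=> [x] /(finite_index_covered (generated_subgroup _))[F cF].
have rep g : exists r : int * G, r.2 \in F /\ g = expgz x r.1 * r.2^-1.
  (* Covering the inverse puts the power of [x] on the left, so that right multiplication by a
     generator interacts only with the representative. *)
  have [f Ff /generated1P[k eq]] := cF g^-1 I.
  exists ((- k)%R, f); split=> //.
  by rewrite expgzN -invgM -eq mulVKg invgK.
have {rep} [r rP] := choice rep; have rF g := (rP g).1; have rE g := (rP g).2.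
pose D := \max_(f <- F) len f.
have lenF g : len (r g).2 <= D by apply: (@leq_bigmax_seq _ _ predT len) (rF g) _.
have [[n [n0 xn]]|inf] := pselect (exists n, (0 < n)%N /\ x ^+ n = 1).
  exists (fun=> 0%R), 0%N, 0%N, (n * len x + D)%N; split=> [g s|g h].
    by rewrite GRing.subrr.
  rewrite add0n [g^-1 * h]rE; apply: leq_trans (lenM genS _ _) _.
  rewrite lenV // leq_add ?lenF //; move: (r _).1 => k.
  have n0' : (n%:Z != 0)%R by rewrite eqz_nat -lt0n.
  have : (0 <= (k %% n)%Z < n)%R by rewrite modz_ge0 // ltz_pmod.
  case kE : (k %% n)%Z => [m|//] /andP[_ mn].
  rewrite (divz_eq k n) kE expgzD expgz_muln xn.
  have -> : expgz (1 : G) (k %/ n)%Z = 1.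
    by case: (k %/ n)%Z => j; rewrite /= expg1n ?invg1.
  by rewrite mul1g; apply: leq_trans (lenX genS _ _) _; rewrite leq_mul2r ltnW ?orbT.
pose kappa y := xget 0%R [set k | y = expgz x k].
have kappaE k : kappa (expgz x k) = k.
  have := @xgetPex _ 0%R [set k' | expgz x k = expgz x k'] (ex_intro _ k erefl).
  rewrite -/(kappa _) => /= eq; apply/eqP; rewrite -GRing.subr_eq0.
  have : expgz x (kappa (expgz x k) - k)%R = 1 by rewrite expgzD expgzN -eq mulgV.
  case: (_ - k)%R => [[|j]|j] //= eq1; case: inf; first by exists j.+1.
  by exists j.+1; split=> //; rewrite -[_ ^+ _]invgK eq1 invg1.
(* If g = x^k f^-1 and g s = x^k' f'^-1, then x^(k' - k) = f^-1 s f': the increment depends on the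
   triple (f, s, f') alone, and there are finitely many. *)
pose step (t : G * S * G) := kappa (t.1.1^-1 * val t.1.2 * t.2).
pose triples := [seq (p.1, p.2, f) | p <- [seq (f, s) | f <- F, s <- enum {: S}], f <- F].
exists (fun g => (r g).1), (\max_(t <- triples) `|step t|%N), (len x), (D + D)%N.
split=> [g s|g h].
  set h := g * val s.
  have -> : ((r h).1 - (r g).1)%R = step ((r g).2, s, (r h).2).
    rewrite /step /= -[LHS]kappaE; congr kappa.
    have eq : h = expgz x (r g).1 * (r g).2^-1 * val s by rewrite -rE.
    rewrite {1}[h]rE in eq.
    rewrite GRing.addrC expgzD expgzN -(mulgVK (r h).2 (expgz x (r h).1)) eq.
    by rewrite !groupE.
  apply: (@leq_bigmax_seq _ _ predT (fun t => `|step t|%N)) => //.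
  apply/allpairsP; exists (((r g).2, s), (r h).2); split=> //=.
  by apply/allpairsP; exists ((r g).2, s); rewrite /= mem_enum.
rewrite {1}[g]rE {1}[h]rE invgM invgK -expgzN.
have -> : (r g).2 * expgz x (- (r g).1)%R * (expgz x (r h).1 * (r h).2^-1) =
    (r g).2 * (expgz x ((r h).1 - (r g).1)%R * (r h).2^-1).
  by rewrite GRing.addrC expgzD !mulgA.
apply: leq_trans (lenM genS _ _) _; rewrite addnCA leq_add ?lenF //.
apply: leq_trans (lenM genS _ _) _; rewrite leq_add ?lenV ?lenF //.
by apply: leq_trans (len_expgz _ _) _; rewrite mulnC distnC.
Qed.

End VirtuallyCyclic.

(** * Clearing denominators, and the two implications *)

Section Main.

Import Order.TTheory GRing.Theory Num.Theory.

(** Rationality of [lambda] enters here: after multiplication by its denominator [q], all terms but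
    [q * epsilon] are integers, and that one can be replaced by its integer part [K]. *)
Lemma quasigeodesic_stretch (R : realType) (G : groupType) (S : {fset G})
    (lambda : rat) (epsilon : R) : (1 <= lambda)%R -> (0 <= epsilon)%R ->
  exists p q K : nat, (0 < q)%N /\
    forall w : seq S, quasigeodesic lambda epsilon w <-> stretch p q K w.
Proof.
move=> l1 e0; pose q := `|denq lambda|%N; pose p := `|numq lambda|%N.
have q0 : (0 < q)%N by rewrite absz_gt0 denq_neq0.
have l0 : (0 <= lambda)%R by apply: le_trans l1.
have qR : (0 < q%:R :> R)%R by rewrite ltr0n.
have lE : (ratr lambda = p%:R / q%:R :> R)%R.
  by rewrite /ratr /p /q !natr_absz !ger0_norm ?numq_ge0 ?denq_ge0.
pose K := Num.truncn (q%:R * epsilon)%R.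
have /andP[K1 K2] : (K%:R <= q%:R * epsilon < K.+1%:R)%R.
  by apply: truncn_itv; rewrite mulr_ge0.
exists p, q, K; split=> // w.
suff eq (n d : nat) :
    ((n%:R <= ratr lambda * d%:R + epsilon :> R)%R) = (q * n <= p * d + K)%N.
  by split=> H u uw; have := H u uw; rewrite eq.
rewrite -(ler_pM2l qR) lE mulrDr mulrA mulrCA divff ?gt_eqF // mulr1 -!natrM.
apply/idP/idP => [le|le].
  rewrite -ltnS -addnS -(ltr_nat R) natrD; apply: le_lt_trans le _.
  by rewrite ltrD2l.
apply: (@le_trans _ _ (p * d + K)%:R%R); first by rewrite ler_nat.
by rewrite natrD lerD2l.
Qed.

Lemma QCF_virtually_cyclic (R : realType) (G : groupType) :
  finitely_generated G -> nilpotent_group G -> QCF R G -> virtually_cyclic G.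
Proof.
move=> [S genS] nilG qcf.
have [//|[a [b [f1 [f2 [f1M f2M [f1a f1b] [f2a f2b]]]]]]] :=
  virtually_cyclic_or_rank2 genS nilG.
have [C1 lip1] := additive_lipschitz genS f1M.
have [C2 lip2] := additive_lipschitz genS f2M.
(* The successor makes [K] at least 1, an admissible value of [lambda]. *)
pose C := (C1 + C2).+1; pose K := (9 * C)%N.
have lip g :
    (`|f1 g| <= (C * word_length S g)%:R /\
     `|f2 g| <= (C * word_length S g)%:R)%R.
  have [C1C C2C] : (C1 <= C)%N /\ (C2 <= C)%N by rewrite /C; lia.
  split; [apply: le_trans (lip1 g) _|apply: le_trans (lip2 g) _];
  by rewrite ler_nat leq_mul2r ?C1C ?C2C orbT.
have K1 : (1 <= K%:R :> rat)%R by rewrite ler1n.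
have := qcf K%:R%R 0%R S K1 (lexx _) genS.
suff -> : [set w : seq S | quasigeodesic K%:R%R (0%R : R) w] = [set w | stretch_le K w].
  by move/(stretch_not_context_free genS f1M f2M f1a f1b f2a f2b nilG lip erefl).
apply/seteqP; split=> w H u uw; have := H u uw; rewrite ratr_nat addr0 -natrM ler_nat //.
Qed.

Lemma virtually_cyclic_QCF (R : realType) (G : groupType) :
  virtually_cyclic G -> QCF R G.
Proof.
move=> vc lambda epsilon S l1 e0 genS.
have [pi [L [A [B [pi_step len_pi]]]]] := virtually_cyclic_quasiline genS vc.
have [p [q [K [q0 eq]]]] := quasigeodesic_stretch S l1 e0.
suff -> : [set w : seq S | quasigeodesic lambda epsilon w] = [set w | stretch p q K w].
  exact: (stretch_context_free genS pi_step len_pi p K q0).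
by apply/seteqP; split=> w /eq.
Qed.

End Main.

Theorem theorem1p4 (R : realType) (G : groupType)
    (G_fg : finitely_generated G) (G_nilpotent : nilpotent_group G) :
  QCF R G <-> virtually_cyclic G.
Proof.
split; first exact: QCF_virtually_cyclic.
exact: virtually_cyclic_QCF.
Qed.
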